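(* Let $\mathcal{Y}$ be a locally compact Polish space, $\theta>0$, $P_0$ a Borel probability measure on $\mathcal{Y}$ without atoms, and $\alpha=\theta P_0$. Let $P_t(x,\mathrm{d}x')$ be the transition function of the Fleming--Viot process defined in the context and $\psi_t$, $t>0$, the associated prediction operator $\psi_t(\nu)(\mathrm{d}x')=\int \nu(\mathrm{d}x)P_t(x,\mathrm{d}x')$. Let $y_1^*,\ldots,y_K^*$ be distinct points of $\mathcal{Y}$ and $\mathbf{m}=(m_1,\ldots,m_K)\in\mathbb{Z}_+^K$. Then $$\psi_t\Big(\Pi_{\alpha+\sum_{i=1}^{K}m_i\delta_{y_i^*}}\Big)=\sum_{\mathbf{n}\in L(\mathbf{m})}p_{\mathbf{m},\mathbf{n}}(t)\,\Pi_{\alpha+\sum_{i=1}^{K}n_i\delta_{y_i^*}},$$ where $L(\mathbf{m})=\{\mathbf{n}\in\mathbb{Z}_+^K:\ n_j\le m_j \text{ for all } j\}$ and $$p_{\mathbf{m},\mathbf{m}-\mathbf{i}}(t)=\begin{cases}e^{-\lambda_{|\mathbf{m}|}t}, & \mathbf{i}=\mathbf{0},\\ C_{|\mathbf{m}|,|\mathbf{m}|-|\mathbf{i}|}(t)\,p(\mathbf{i};\mathbf{m},|\mathbf{i}|), & \mathbf{0}<\mathbf{i}\le\mathbf{m},\end{cases}$$ with $$C_{|\mathbf{m}|,|\mathbf{m}|-|\mathbf{i}|}(t)=\Big(\prod_{h=0}^{|\mathbf{i}|-1}\lambda_{|\mathbf{m}|-h}\Big)(-1)^{|\mathbf{i}|}\sum_{k=0}^{|\mathbf{i}|}\frac{e^{-\lambda_{|\mathbf{m}|-k}t}}{\prod_{0\le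 h\le|\mathbf{i}|,\,h\ne k}(\lambda_{|\mathbf{m}|-k}-\lambda_{|\mathbf{m}|-h})},$$ $\lambda_n=n(\theta+n-1)/2$, and $p(\mathbf{i};\mathbf{m},|\mathbf{i}|)=\binom{|\mathbf{m}|}{|\mathbf{i}|}^{-1}\prod_{j=1}^{K}\binom{m_j}{i_j}$ the multivariate hypergeometric probability.
   Context: Notation: $\mathbb{Z}_+=\{0,1,2,\ldots\}$; $|\mathbf{m}|=\sum_j m_j$; $\mathbf{i}\le\mathbf{m}$ means $i_j\le m_j$ for all $j$, and $\mathbf{i}<\mathbf{m}$ means in addition that some inequality is strict; $\mathbf{0}$ is the zero vector. Dirichlet process law: for a finite nonzero Borel measure $\gamma$ on $\mathcal{Y}$, $\Pi_\gamma$ is the law, on the space $\mathcal{M}_1(\mathcal{Y})$ of Borel probability measures on $\mathcal{Y}$, of the random probability measure $x$ such that for every measurable partition $A_1,\ldots,A_k$ of $\mathcal{Y}$, $(x(A_1),\ldots,x(A_k))$ has the Dirichlet distribution with parameters $(\gamma(A_1),\ldots,\gamma(A_k))$ (coordinates with zero parameter being a.s. zero). Fleming--Viot process: the $\mathcal{M}_1(\mathcal{Y})$-valued Markov process with transition function, for $t>0$, $$P_t(x,\mathrm{d}x')=\sum_{m=0}^\infty d_m(t)\int_{\mathcal{Y}^m}\Pi_{\alpha+\sum_{i=1}^m\delta_{y_i}}(\mathrm{d}x')\,x^{m}(\mathrm{d}y_1,\ldots,\mathrm{d}y_m),$$ where $x^m$ is the $m$-fold product measure of $x$, and $d_m(t)$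 is the probability that a pure-death process on the nonnegative integers, jumping from $m$ to $m-1$ at rate $\lambda_m=\frac12 m(\theta+m-1)$ and started at infinity at time $0$, is in state $m$ at time $t$ (i.e. $d_m(t)=\lim_{n\to\infty}\mathbb{P}(D_t=m\mid D_0=n)$). *)

(* Defs.v *)
From HB Require Import structures.
From mathcomp Require Import all_boot all_order all_algebra.
From mathcomp Require Import all_classical all_reals all_analysis.
From mathcomp Require Import measurable_realfun.

Set Implicit Arguments.
Unset Strict Implicit.
Unset Printing Implicit Defensive.

Import Order.TTheory GRing.Theory Num.Theory.
Import numFieldTopology.Exports numFieldNormedType.Exports.

Local Open Scope classical_set_scope.
Local Open Scope ring_scope.

Section polish.
Variables (R : realType) (Y : topologicalType).

Definition is_metric (d : Y -> Y -> R) :=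
  [/\ forall x y, d x y = 0 <-> x = y,
      forall x y, d x y = d y x &
      forall x y z, d x z <= d x y + d y z].

Definition metrizes (d : Y -> Y -> R) :=
  forall (x : Y) (A : set Y),
    nbhs x A <-> exists2 e : R, 0 < e & [set y | d x y < e] `<=` A.

Definition complete_metric (d : Y -> Y -> R) :=
  forall u : nat -> Y,
    (forall e : R, 0 < e -> exists N : nat,
       forall i j : nat, (N <= i)%N -> (N <= j)%N -> d (u i) (u j) < e) ->
    exists l : Y, u @ \oo --> l.

Definition polish_space :=
  (exists2 D : set Y, countable D & dense D) /\
  (exists d : Y -> Y -> R, [/\ is_metric d, metrizes d & complete_metric d]).

End polish.

(* Y is pointed because the library requires it of measurable types. *)
Notation borel Y := (g_sigma_algebraType (@open Y)).

Section tuple_product.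
Context d (T : measurableType d) (R : realType).

Definition tcons n (p : T * n.-tuple T) : n.+1.-tuple T :=
  [the n.+1.-tuple T of p.1 :: p.2].

Lemma measurable_tcons n : measurable_fun [set: T * n.-tuple T] (@tcons n).
Proof. exact: measurable_cons. Qed.

HB.instance Definition _ n :=
  isMeasurableFun.Build _ _ _ _ (@tcons n) (@measurable_tcons n).

Fixpoint tuple_product n : ('I_n -> probability T R) -> probability (n.-tuple T) R :=
  match n with
  | 0 => fun _ => \d_[tuple]
  | n'.+1 => fun P =>
      distribution (P ord0 \x tuple_product (fun i => P (lift ord0 i)))%E (@tcons n')
  end.

End tuple_product.

Section gamma_weight.
Context {R : realType}.
Local Notation mu := lebesgue_measure.

Definition gamma_density (a x : R) : R :=
  ((fun x => x `^ (a - 1) * expR (- x)) \_ `]0, +oo[) x.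

Lemma gamma_density_ge0 a x : 0 <= gamma_density a x.
Proof.
by apply: restrict_ge0 => y _; rewrite mulr_ge0 ?powR_ge0 ?expR_ge0.
Qed.

Lemma measurable_gamma_density a : measurable_fun [set: R] (gamma_density a).
Proof.
apply/measurable_restrict => //; apply: measurable_funTS.
apply: measurable_funM; first exact: measurable_powR.
exact: measurableT_comp.
Qed.

Definition gamma_weight (a : R) (V : set R) : \bar R :=
  (\int[mu]_(x in V) (gamma_density a x)%:E)%E.

Let gamma_weight0 a : gamma_weight a set0 = 0%E.
Proof. by rewrite /gamma_weight integral_set0. Qed.

Let gamma_weight_ge0 a V : (0 <= gamma_weight a V)%E.
Proof. by apply: integral_ge0 => x _; rewrite lee_fin gamma_density_ge0. Qed.

Let gamma_weight_sigma_additive a : semi_sigma_additive (gamma_weight a).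
Proof.
move=> /= F mF tF mUF; rewrite /gamma_weight; apply: cvg_toP.
  apply: ereal_nondecreasing_is_cvgn => m n mn.
  apply: lee_sum_nneg_natr => // k _ _; exact: gamma_weight_ge0.
rewrite ge0_integral_bigcup//=.
- by apply/measurable_funTS/measurableT_comp => //; exact: measurable_gamma_density.
- by move=> x _; rewrite lee_fin gamma_density_ge0.
Qed.

HB.instance Definition _ a := isMeasure.Build _ _ _ (gamma_weight a)
  (gamma_weight0 a) (gamma_weight_ge0 a) (@gamma_weight_sigma_additive a).

End gamma_weight.

Section dirichlet_distribution.
Context {R : realType}.

(* The Gamma(a, 1) law: for a > 0 the total mass of [gamma_weight a] is the
   finite number Gamma(a), so [mnormalize] does divide by it. *)
Definition gamma_law (a : R) : probability R R :=
  if 0 < a then [the probability R R of mnormalize (gamma_weight a) \d_(0 : R)]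
  else [the probability R R of \d_(0 : R)].

(* Law of (Z_1 / S, ..., Z_k / S), S = Z_1 + ... + Z_k, where the Z_j are
   independent and Gamma(a_j, 1)-distributed, Z_j = 0 when a_j = 0. *)
Definition dirichlet_distribution k (a : 'I_k -> R) (B : set (k.-tuple R)) :
    \bar R :=
  pushforward (tuple_product (fun j => gamma_law (a j)))
    (fun z => [tuple tnth z j / \sum_(i < k) tnth z i | j < k]) B.

End dirichlet_distribution.

Definition random_measure_law d (T : measurableType d) (R : realType) :=
  probability (pprobability T R) R.

Section dirichlet_process.
Context d (T : measurableType d) (R : realType).
Local Open Scope ereal_scope.

Definition is_dirichlet_process (gamma : {measure set T -> \bar R})
    (Q : random_measure_law T R) :=
  forall (k : nat) (A : 'I_k -> set T),
    (forall j, measurable (A j)) -> trivIset setT A ->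
    \bigcup_j A j = [set: T] ->
    forall B : set (k.-tuple R), measurable B ->
      Q [set x | B [tuple fine ((x : probability T R) (A j)) | j < k]] =
      dirichlet_distribution (fun j => fine (gamma (A j))) B.

Definition is_dirichlet_family
    (Pi : {measure set T -> \bar R} -> random_measure_law T R) :=
  forall gamma : {measure set T -> \bar R},
    gamma [set: T] != 0 -> gamma [set: T] < +oo ->
    is_dirichlet_process gamma (Pi gamma).

End dirichlet_process.

Section add_atoms.
Context d (T : measurableType d) (R : realType).
Local Open Scope ereal_scope.
Variables (alpha : {measure set T -> \bar R}) (K : nat).
Variables (w : 'I_K -> nat) (y : 'I_K -> T).

Definition add_atoms (A : set T) : \bar R :=
  alpha A + \sum_(j < K) (w j)%:R%:E * \d_(y j) A.

Let add_atoms0 : add_atoms set0 = 0.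
Proof.
by rewrite /add_atoms measure0 add0e big1// => j _; rewrite measure0 mule0.
Qed.

Let add_atoms_ge0 A : 0 <= add_atoms A.
Proof. by rewrite adde_ge0// sume_ge0// => j _; rewrite mule_ge0. Qed.

Let add_atoms_sigma_additive : semi_sigma_additive add_atoms.
Proof.
pose F (s : seq 'I_K) : {measure set T -> \bar R} :=
  foldr (fun j (mu : {measure set T -> \bar R}) =>
    measure_add (mscale (NngNum (ler0n R (w j))) (\d_(y j))) mu) mzero s.
have FE s A : F s A = \sum_(j <- s) (w j)%:R%:E * \d_(y j) A.
  elim: s => [|j s IH]; first by rewrite big_nil.
  by rewrite big_cons -IH; exact: measure_addE.
have -> : add_atoms = measure_add alpha (F (index_enum _)).
  by apply/funext => A; rewrite [RHS]measure_addE FE.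
exact: measure_semi_sigma_additive.
Qed.

HB.instance Definition _ := isMeasure.Build _ _ _ add_atoms
  add_atoms0 add_atoms_ge0 add_atoms_sigma_additive.

End add_atoms.

Section pure_death.
Context {R : realType}.

Definition death_rate (theta : R) (n : nat) : R :=
  n%:R * (theta + n%:R - 1) / 2.

Definition death_generator (rate : nat -> R) (n k : nat) : R :=
  if n == k then - rate n else if n == k.+1 then rate n else 0.

(* [P t n k] is P(D_t = k | D_0 = n): D is the continuous-time Markov chain on
   the nonnegative integers with jump rates [death_generator rate]. *)
Definition is_pure_death (rate : nat -> R) (P : R -> nat -> nat -> R) :=
  [/\ forall t n k, 0 <= t -> 0 <= P t n k,
      forall t n, 0 <= t -> (\sum_(0 <= k <oo) (P t n k)%:E = 1)%E,
      forall n k, P 0 n k = (n == k)%:R,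
      forall s t n k, 0 <= s -> 0 <= t ->
        ((P (s + t) n k)%:E = \sum_(0 <= l <oo) (P s n l * P t l k)%:E)%E &
      forall n k,
        (P h n k - (n == k)%:R) / h @[h --> 0^'+] --> death_generator rate n k].

Definition death_from_infinity (P : R -> nat -> nat -> R) (m : nat) (t : R) : R :=
  lim (P t n m @[n --> \oo]).

End pure_death.

Section fleming_viot.
Context d (T : measurableType d) (R : realType).
Local Open Scope ereal_scope.
Variables (alpha : {measure set T -> \bar R}).
Variables (Pi : {measure set T -> \bar R} -> random_measure_law T R).
Variables (death : R -> nat -> nat -> R).

Definition fleming_viot (t : R) (x : probability T R)
    (B : set (pprobability T R)) : \bar R :=
  \sum_(0 <= m <oo) (death_from_infinity death m t)%:E *
    \int[tuple_product (fun _ : 'I_m => x)]_y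
      Pi (add_atoms alpha (fun=> 1%N) (tnth y)) B.

Definition prediction (t : R) (nu : random_measure_law T R)
    (B : set (pprobability T R)) : \bar R :=
  \int[nu]_x fleming_viot t x B.

End fleming_viot.

Section coefficients.
Context {R : realType}.
Variables (theta : R) (K : nat).
Implicit Types (m i n : {ffun 'I_K -> nat}).

Local Notation lambda := (death_rate theta).

Definition size_vec m : nat := (\sum_(j < K) m j)%N.

Definition lower_set m : set {ffun 'I_K -> nat} :=
  [set n | forall j, (n j <= m j)%N].

(* C_{M, M - r}(t) *)
Definition death_coef (M r : nat) (t : R) : R :=
  (\prod_(0 <= h < r) lambda (M - h)%N) * (-1) ^+ r *
  \sum_(0 <= k < r.+1)
    (expR (- lambda (M - k)%N * t) /
     \prod_(0 <= h < r.+1 | h != k) (lambda (M - k)%N - lambda (M - h)%N)).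

Definition hypergeometric i m : R :=
  'C(size_vec m, size_vec i)%:R^-1 * \prod_(j < K) 'C(m j, i j)%:R.

(* p_{m, m - i}(t) *)
Definition loss_prob m i (t : R) : R :=
  if i == [ffun=> 0%N] then expR (- lambda (size_vec m) * t)
  else death_coef (size_vec m) (size_vec i) t * hypergeometric i m.

(* p_{m, n}(t), for n <= m *)
Definition transition_prob m n (t : R) : R :=
  loss_prob m [ffun j => (m j - n j)%N] t.

End coefficients.

(* Main.v *)
(* Draw x from Pi_(alpha + sum_l m_l delta_(y_l)), then z_1, ..., z_M independently
   from x. The average of Pi_(alpha + sum_j delta_(z_j)) is
     sum_(i <= m) prod_l C(m_l, i_l) w_M(|m|, |i|) Pi_(alpha + sum_l i_l delta_(y_l)),
   where w_M depends only on the total counts. For the finite-dimensional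
   marginals this follows by induction on M from size-biasing the coordinates of a
   Dirichlet vector; cylinder sets then determine the laws. It remains to average
   w_M over the number M of lines present at time t. The kernel
   h_M(s, r) = C(s, r) w_M(s, r) is symmetric in M and s and intertwines the
   generator of the pure-death chain with itself, so its average over the chain
   started from N at time t is sum_u P(D_t = u | D_0 = s) h_N(u, r), the transition
   probabilities from s being the divided differences C_(s, u)(t). Since
   h_N(u, r) tends to [u = r] as N grows, and the laws of the chain started from N
   are tight, the average over the chain started at infinity is C_(s, r)(t). *)

Require Import Defs.
From HB Require Import structures.
From mathcomp Require Import all_boot all_order all_algebra.
From mathcomp Require Import all_classical all_reals all_analysis.
From mathcomp Require Import measurable_realfun.
From mathcomp Require Import ring lra.

Set Implicit Arguments.
Unset Strict Implicit.
Unset Printing Implicit Defensive.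

Import Order.TTheory GRing.Theory Num.Theory.
Import numFieldTopology.Exports numFieldNormedType.Exports.

Local Open Scope classical_set_scope.
Local Open Scope ring_scope.

(** * Gamma weights *)

(** Size-biasing a Dirichlet vector is usually read off from the independence of the total S = Z_1 +
    ... + Z_k and Z / S. Here it comes from exponential tilting: weighting the Gamma laws by e^((1 -
    c) S) rescales Z, which Z / S does not see, and differentiating at c = 1 gives E[S f(Z / S)] =
    (sum_j b_j) E[f(Z / S)]. The same device yields Gamma(a + 1) = a Gamma(a). Null cells have
    parameter 0, so the identities have to include the Dirac law at 0.

    The chain is known only through its semigroup property and the right derivatives of its entries
    at time 0. Averages of the duality function are therefore compared through difference estimates
    uniform in time.

    The entrance probabilities are a [lim], meaningful only once convergence is proved. The symmetry
    of h supplies it: for fixed M, h_M(s, r) tends to [M = r] as s grows, so, up to a tight tail,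
    P(D_t = r | D_0 = N) is approximated uniformly in N by averages of h, and these converge in
    N. *)

Section measurable_induction.
Context d (T : measurableType d) (R : realType).
Local Open Scope ereal_scope.
Import HBNNSimple.

(** A nonnegative measurable function is an increasing limit of simple functions, and each of these
    is a finite sum of scaled indicators. *)
Lemma ge0_measurable_ind (Q : (T -> \bar R) -> Prop) :
  (forall A, measurable A -> Q (EFin \o \1_A)) ->
  (forall (k : R) f, (0 <= k)%R -> measurable_fun setT f -> (forall x, 0 <= f x) ->
    Q f -> Q (fun x => k%:E * f x)) ->
  (forall f g, measurable_fun setT f -> (forall x, 0 <= f x) -> Q f ->
    measurable_fun setT g -> (forall x, 0 <= g x) -> Q g -> Q (f \+ g)) ->
  (forall f : nat -> T -> \bar R, (forall n, measurable_fun setT (f n)) ->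
    (forall n x, 0 <= f n x) -> (forall x, {homo f ^~ x : n m / (n <= m)%N >-> n <= m}) ->
    (forall n, Q (f n)) -> Q (fun x => limn (f ^~ x))) ->
  forall f, measurable_fun setT f -> (forall x, 0 <= f x) -> Q f.
Proof.
move=> Qi QZ QD Ql f mf f0.
pose g := nnsfun_approx measurableT mf.
have -> : f = (fun x => limn ((fun n => EFin \o g n)^~ x)).
  apply/funext => x; apply/esym/cvg_lim => //.
  exact: (@cvg_nnsfun_approx _ _ _ setT measurableT f mf (fun t _ => f0 t) x I).
apply: Ql => [n|n x|x m n mn|n].
- exact/measurable_EFinP.
- by rewrite lee_fin.
- by rewrite lee_fin; exact/lefP/nd_nnsfun_approx.
pose h : {nnsfun T >-> R} := g n.
(* The sum runs over an arbitrary list of values so that induction applies; the empty sum is reached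
   as 0 times the indicator of the whole space. *)
have Qs (s : seq R) : (forall r, r \in s -> (0 <= r)%R) ->
    Q (fun x => \sum_(r <- s) (r * \1_(h @^-1` [set r]) x)%:E).
  elim: s => [_|r s IH rs].
    rewrite (_ : (fun _ => _) = (fun x => 0%:E * (EFin \o \1_setT) x)); last first.
      by apply/funext => x; rewrite big_nil mul0e.
    by apply: QZ => //; [exact/measurable_EFinP|move=> x; rewrite lee_fin|exact: Qi].
  rewrite (_ : (fun _ => _) = (fun x => r%:E * (EFin \o \1_(h @^-1` [set r])) x) \+
      (fun x => \sum_(r <- s) (r * \1_(h @^-1` [set r]) x)%:E)); last first.
    by apply/funext => x; rewrite big_cons.
  have r0 : (0 <= r)%R by apply: rs; rewrite mem_head.
  have s0 q : q \in s -> (0 <= q)%R by move=> qs; apply: rs; rewrite inE qs orbT.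
  apply: QD.
  - apply/measurable_funeM; exact/measurable_EFinP.
  - by move=> x; rewrite mule_ge0// lee_fin.
  - by apply: QZ => //; [exact/measurable_EFinP|move=> x; rewrite lee_fin|exact: Qi].
  - by apply: emeasurable_sum => q; apply/measurable_EFinP/measurable_funM.
  - by move=> x; rewrite big_seq sume_ge0// => q qs; rewrite lee_fin mulr_ge0// s0.
  - exact: IH.
rewrite (_ : _ \o _ = (fun x => \sum_(r <- finmap.enum_fset (fset_set (range h))) (r * \1_(h @^-1` [set r]) x)%:E)).
  apply: Qs => r; rewrite in_fset_set// inE => -[x _ <-]; exact: fun_ge0.
by apply/funext => x; rewrite /= [g n x]fimfunE fsbig_finite//= sumEFin.
Qed.

Lemma ge0_integral_density (mu nu : {measure set T -> \bar R}) (g : T -> R) :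
  measurable_fun setT g -> (forall x, 0 <= g x)%R ->
  (forall A, measurable A -> nu A = \int[mu]_(x in A) (g x)%:E) ->
  forall f, measurable_fun setT f -> (forall x, 0 <= f x) ->
  \int[nu]_x f x = \int[mu]_x (f x * (g x)%:E).
Proof.
move=> mg g0 nuE.
have mgE : measurable_fun setT (EFin \o g) by exact/measurable_EFinP.
apply: ge0_measurable_ind => [A mA|k f k0 mf f0 Qf|f h mf f0 Qf mh h0 Qh|f mf f0 ndf Qf].
- rewrite [LHS]integral_indic// setIT nuE// integral_mkcond.
  apply: eq_integral => x _; rewrite patchE/= indicE.
  by case: (x \in A); rewrite ?mul1e ?mul0e.
- rewrite ge0_integralZl// Qf -ge0_integralZl//.
  + by apply: eq_integral => x _; rewrite muleA.
  + exact: emeasurable_funM.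
  + by move=> x _; rewrite mule_ge0// lee_fin.
- rewrite ge0_integralD// Qf Qh -ge0_integralD//.
  + by apply: eq_integral => x _; rewrite ge0_muleDl.
  + by move=> x _; rewrite mule_ge0// lee_fin.
  + exact: emeasurable_funM.
  + by move=> x _; rewrite mule_ge0// lee_fin.
  + exact: emeasurable_funM.
- rewrite monotone_convergence//.
  under eq_fun do rewrite Qf.
  rewrite -monotone_convergence//.
  + apply: eq_integral => x _; rewrite limeMr//.
    exact/ereal_nondecreasing_is_cvgn/ndf.
  + by move=> n; exact: emeasurable_funM.
  + by move=> n x _; rewrite mule_ge0// lee_fin.
  + by move=> x _ m n mn; rewrite lee_wpmul2r ?lee_fin// ndf.
Qed.

End measurable_induction.

Section gamma_law.
Context {R : realType}.
Local Notation mu := (@lebesgue_measure R).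
Local Open Scope ereal_scope.

(** The image of Lebesgue measure under multiplication by c, scaled by c, agrees with Lebesgue
    measure on half-open intervals, hence everywhere. *)
Lemma ge0_integral_lebesgue_scale (c : R) (f : R -> \bar R) : (0 < c)%R ->
  measurable_fun setT f -> (forall x, 0 <= f x) ->
  \int[mu]_x f x = c%:E * \int[mu]_x f (c * x)%R.
Proof.
move=> c0 mf f0.
have mc : measurable_fun [set: measurableTypeR R] ( *%R c : measurableTypeR R -> measurableTypeR R).
  exact: measurable_funM.
pose k : {nonneg R} := NngNum (ltW c0).
rewrite -(ge0_integral_pushforward mc mu measurableT mf)//.
rewrite -[c%:E]/(k%:num%:E) -ge0_integral_mscale//.
apply: eq_measure_integral => A mA _; move: A mA.
apply: lebesgue_measure_unique => _ [[a b]] _ <-.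
rewrite [RHS]/= /mscale /=.
rewrite /pushforward (_ : *%R c @^-1` _ = `](a / c)%R, (b / c)%R]%classic); last first.
  apply/seteqP; split => x /=; rewrite !in_itv/= ltr_pdivrMr// ler_pdivlMr//;
    by rewrite [(x * c)%R]mulrC.
rewrite !lebesgue_measure_itv/= !lte_fin ltr_pM2r ?invr_gt0//.
case: ifPn => ab; last by rewrite mule0.
by rewrite -!EFinD -EFinM -mulrBl mulrC divfK ?gt_eqF.
Qed.

Lemma ge0_integral_gamma_weight (a : R) (f : R -> \bar R) :
  measurable_fun setT f -> (forall x, 0 <= f x) ->
  \int[gamma_weight a]_x f x = \int[mu]_x (f x * (gamma_density a x)%:E).
Proof.
move=> mf f0.
have mid : measurable_fun [set: measurableTypeR R] (id : measurableTypeR R -> R).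
  by [].
(* Lebesgue measure is transported along the identity from [measurableTypeR R] to [R], so that it
   lives on the same measurable type as [gamma_weight a]. *)
pose mu0 : {measure set R -> \bar R} := pushforward mu (id : measurableTypeR R -> R).
pose mu' := mu0 mid.
have mu'E (A : set R) (h : R -> \bar R) : measurable A -> measurable_fun setT h ->
    (forall x, 0 <= h x) -> \int[mu']_(x in A) h x = \int[mu]_(x in A) h x.
  move=> mA mh h0; rewrite (ge0_integral_pushforward mid)//.
  exact: measurable_funTS.
rewrite (@ge0_integral_density _ _ R mu' _ (gamma_density a))//.
- rewrite mu'E//.
  + apply: emeasurable_funM => //; apply/measurable_EFinP.
    exact: measurable_gamma_density.
  + by move=> x; rewrite mule_ge0// lee_fin gamma_density_ge0.
- exact: measurable_gamma_density.
- exact: gamma_density_ge0.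
- move=> A mA; rewrite mu'E//; first by apply/measurable_EFinP; exact: measurable_gamma_density.
  by move=> x; rewrite lee_fin gamma_density_ge0.
Qed.

Lemma gamma_densityE (a x : R) : gamma_density a x =
  if (0 < x)%R then (x `^ (a - 1) * expR (- x))%R else 0%R.
Proof. by rewrite /gamma_density patchE mem_setE in_itv/= andbT. Qed.

(** The absolute value keeps the factor nonnegative off the support, as integrals of nonnegative
    functions require; the density vanishes there anyway. *)
Lemma gamma_densityS (a x : R) : gamma_density (a + 1) x = (`|x| * gamma_density a x)%R.
Proof.
rewrite !gamma_densityE; case: ifPn => [x0|_]; last by rewrite mulr0.
rewrite gtr0_norm// mulrA addrK -[X in (_ = X * _ * _)%R](powRr1 (ltW x0)).
by rewrite -powRD ?(gt_eqF x0) ?implybT// addrC subrK.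
Qed.

(* The exponential tilt of the Gamma(a) weight is, up to the factor c^-a, its
   image under division by c. *)
Lemma gamma_weight_scale (a c : R) (f : R -> \bar R) : (0 < c)%R ->
  measurable_fun setT f -> (forall x, 0 <= f x) ->
  \int[gamma_weight a]_x (f x * (expR ((1 - c) * `|x|))%:E) =
  (c `^ (- a))%:E * \int[gamma_weight a]_x f (x / c)%R.
Proof.
move=> c0 mf f0.
have mdiv : measurable_fun [set: R] (fun x : R => x / c)%R by exact: measurable_funM.
have mfdiv : measurable_fun [set: R] (fun x : R => f (x / c)%R) by exact: measurableT_comp.
have mexp : measurable_fun [set: R] (fun x : R => expR ((1 - c) * `|x|)).
  by apply: measurableT_comp => //; apply: measurable_funM => //; exact: measurableT_comp.
have mgd : measurable_fun [set: R] (EFin \o gamma_density a).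
  by apply/measurable_EFinP; exact: measurable_gamma_density.
rewrite !ge0_integral_gamma_weight//; last 2 first.
- by apply: emeasurable_funM => //; exact/measurable_EFinP.
- by move=> x; rewrite mule_ge0// lee_fin expR_ge0.
rewrite [in RHS](ge0_integral_lebesgue_scale c0)//; last 2 first.
- exact: emeasurable_funM.
- by move=> x; rewrite mule_ge0// lee_fin gamma_density_ge0.
rewrite muleA -EFinM -ge0_integralZl//.
- apply: eq_integral => x _; rewrite mulrAC divff ?gt_eqF// mul1r muleCA -muleA.
  congr (_ * _); rewrite -!EFinM !gamma_densityE pmulr_rgt0//.
  case: ifPn => [x0|_]; last by rewrite !mulr0.
  rewrite gtr0_norm// powRM ?(ltW x0) ?(ltW c0)//; congr (_%:E).
  rewrite (_ : expR (- (c * x)) = expR ((1 - c) * x) * expR (- x))%R; last first.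
    by rewrite -expRD; congr expR; ring.
  rewrite (_ : c `^ (- a) * c * (c `^ (a - 1) * _ * _) =
    (c `^ (- a) * (c * c `^ (a - 1))) * (x `^ (a - 1) * (expR ((1 - c) * x) * expR (- x))))%R; last by ring.
  rewrite -[X in (_ * (X * c `^ (a - 1)) * _)%R](powRr1 (ltW c0)) -!powRD ?(gt_eqF c0) ?implybT//.
  rewrite (_ : - a + (1 + (a - 1)) = 0)%R; last by ring.
  by rewrite powRr0 mul1r; ring.
- apply: emeasurable_funM => //; first by apply: measurableT_comp => //; exact: measurable_funM.
  by apply: (measurableT_comp mgd); exact: measurable_funM.
- by move=> x _; rewrite mule_ge0// lee_fin gamma_density_ge0.
- by rewrite lee_fin mulr_ge0 ?powR_ge0// ltW.
Qed.

Lemma gamma_weightS (a : R) (f : R -> \bar R) :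
  measurable_fun setT f -> (forall x, 0 <= f x) ->
  \int[gamma_weight a]_x (`|x|%:E * f x) = \int[gamma_weight (a + 1)]_x f x.
Proof.
move=> mf f0.
have mn : measurable_fun [set: R] (fun x : R => `|x|%:E).
  by apply/measurable_EFinP; exact: normr_measurable.
have mnf : measurable_fun setT (fun x : R => `|x|%:E * f x) by exact: emeasurable_funM.
have nf0 x : 0 <= `|x|%:E * f x by rewrite mule_ge0.
rewrite (ge0_integral_gamma_weight _ mnf nf0) (ge0_integral_gamma_weight _ mf f0).
by apply: eq_integral => x _; rewrite gamma_densityS EFinM muleA [_ * f x]muleC.
Qed.

Lemma eq_integral_gamma_weight (a : R) (f g : R -> \bar R) :
  measurable_fun setT f -> (forall x, 0 <= f x) ->
  measurable_fun setT g -> (forall x, 0 <= g x) -> (forall x, 0 <= x -> f x = g x)%R ->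
  \int[gamma_weight a]_x f x = \int[gamma_weight a]_x g x.
Proof.
move=> mf f0 mg g0 fg; rewrite !ge0_integral_gamma_weight//.
apply: eq_integral => x _; rewrite gamma_densityE.
by case: ifPn => [x0|_]; rewrite ?mule0// fg// ltW.
Qed.

End gamma_law.

(** * Exponential tilting *)

Section tilting.
Context {R : realType}.

(** The right-hand side equals I at c = 1, so c = 1 is a minimum and the derivative J - beta I
    vanishes there. The substitution c = e^u turns the powers into exponentials and the minimum into
    one at u = 0, interior to [-1, 1]. *)
Lemma tangent_at_one (beta I J : R) :
  (forall c, 0 < c -> I <= c `^ (- beta) * I + (c - 1) * J) -> J = beta * I.
Proof.
move=> H; pose psi (u : R) : R := expR (- beta * u) * I + expR u * J.
have dpsi (u : R) : is_derive u (1 : R) psi ((- beta * expR (- beta * u)) * I + expR u * J).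
  rewrite /psi; apply: is_derive_eq.
  rewrite /GRing.scale/=; ring.
have [] := @derive1_at_min R psi (-1) 1 0.
- lra.
- by move=> t _; have [] := dpsi t.
- by rewrite in_itv/= ltrN10 ltr01.
- move=> t _; have := H (expR t) (expR_gt0 t); rewrite /psi -expRM mulr0 expR0 [t * _]mulrC.
  lra.
- by move=> _; have [_ ->] := dpsi 0; rewrite mulr0 expR0; lra.
Qed.

Local Open Scope ereal_scope.

(* Differentiating the tilt identity at c = 1; e^x >= 1 + x stands in for
   dominated convergence. *)
Lemma tilt_expectation d (T : measurableType d) (mu : {measure set T -> \bar R})
    (S : T -> R) (g : T -> \bar R) (beta : R) :
  measurable_fun setT S -> (forall x, 0 <= S x)%R ->
  measurable_fun setT g -> (forall x, 0 <= g x) -> \int[mu]_x g x < +oo ->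
  (forall c : R, (0 < c)%R -> \int[mu]_x (g x * (expR ((1 - c) * S x))%:E) =
    (c `^ (- beta))%:E * \int[mu]_x g x) ->
  \int[mu]_x ((S x)%:E * g x) = beta%:E * \int[mu]_x g x.
Proof.
move=> mS S0 mg g0 goo tilt.
set I := \int[mu]_x g x in goo tilt *; set J := \int[mu]_x _.
have mSE : measurable_fun setT (EFin \o S) by exact/measurable_EFinP.
have mSg : measurable_fun setT (fun x => (S x)%:E * g x) by exact: emeasurable_funM.
have Sg0 x : 0 <= (S x)%:E * g x by rewrite mule_ge0// lee_fin.
have mexp (c : R) : measurable_fun setT (fun x => (expR ((1 - c) * S x))%:E).
  by apply/measurable_EFinP; apply: measurableT_comp => //; exact: measurable_funM.
have mgexp (c : R) : measurable_fun setT (fun x => g x * (expR ((1 - c) * S x))%:E).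
  exact: emeasurable_funM.
have gexp0 (c : R) x : 0 <= g x * (expR ((1 - c) * S x))%:E.
  by rewrite mule_ge0// lee_fin expR_ge0.
have I0 : 0 <= I by exact: integral_ge0.
have J0 : 0 <= J by exact: integral_ge0.
have Ifin : I \is a fin_num by rewrite ge0_fin_numE.
have low (c : R) : (0 < c)%R -> (c <= 1)%R -> I + (1 - c)%:E * J <= (c `^ (- beta))%:E * I.
  move=> c0 c1; rewrite -tilt// /I /J -ge0_integralZl//; last by rewrite lee_fin subr_ge0.
  rewrite -ge0_integralD//; last 2 first.
  - by move=> x _; rewrite mule_ge0// lee_fin subr_ge0.
  - exact: measurable_funeM.
  apply: ge0_le_integral => //.
  - by move=> x _; rewrite adde_ge0// mule_ge0// lee_fin subr_ge0.
  - by apply: emeasurable_funD => //; exact: measurable_funeM.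
  - move=> x _; have -> : g x + (1 - c)%:E * ((S x)%:E * g x) = (1 + (1 - c) * S x)%:E * g x.
      by rewrite (EFinD 1 ((1 - c) * S x)) ge0_muleDl ?lee_fin// ?mulr_ge0 ?subr_ge0// mul1e EFinM muleA.
    by rewrite muleC lee_wpmul2l// lee_fin expR_ge1Dx.
(* For c >= 1 the same tangent bound is written with (c - 1) J on the right, so that every term is
   nonnegative. *)
have high (c : R) : (1 <= c)%R -> I <= (c `^ (- beta))%:E * I + (c - 1)%:E * J.
  move=> c1; have c0 : (0 < c)%R by exact: lt_le_trans c1.
  rewrite -tilt// /I /J -ge0_integralZl//; last by rewrite lee_fin subr_ge0.
  rewrite -ge0_integralD//; last 2 first.
  - by move=> x _; rewrite mule_ge0// lee_fin subr_ge0.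
  - exact: measurable_funeM.
  apply: ge0_le_integral => //.
  - by apply: emeasurable_funD => //; exact: measurable_funeM.
  - move=> x _; rewrite muleA -EFinM [_ * g x]muleC -ge0_muleDr ?lee_fin ?expR_ge0 ?mulr_ge0 ?subr_ge0//.
    rewrite -EFinD -[leLHS]mule1 lee_wpmul2l// lee_fin.
    by have := expR_ge1Dx ((1 - c) * S x); lra.
(* The bound [low] at c = 1/2 dominates J / 2 by a finite multiple of the finite I. *)
have Jfin : J \is a fin_num.
  have half0 : (0 < 2^-1 :> R)%R by rewrite invr_gt0.
  have half1 : (2^-1 <= 1 :> R)%R by rewrite invf_le1 ?ler1n.
  rewrite ge0_fin_numE//; move: (low _ half0 half1); rewrite leNgt; apply: contraNT.
  rewrite -leNgt leye_eq => /eqP ->; rewrite gt0_muley ?lte_fin ?subr_gt0 ?invf_lt1 ?ltr1n//.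
  by rewrite addey ?gt_eqF// ?(lt_le_trans ltNy0)// ltey_eq fin_numM.
rewrite -(fineK Ifin) -(fineK Jfin) -EFinM; congr (_%:E).
apply: tangent_at_one => c c0.
have [c1|/ltW c1] := leP 1%R c.
  by have := high _ c1; rewrite -(fineK Ifin) -(fineK Jfin) -!EFinM -EFinD lee_fin.
have := low _ c0 c1; rewrite -(fineK Ifin) -(fineK Jfin) -!EFinM -EFinD lee_fin; lra.
Qed.

End tilting.

(** * Finiteness and positivity of the Gamma mass *)

Section gamma_mass.
Context {R : realType}.
Local Notation mu := (@lebesgue_measure R).
Local Open Scope ereal_scope.
Implicit Type a : R.

Lemma gamma_weightTE a : gamma_weight a setT = \int[mu]_x (gamma_density a x)%:E.
Proof. by []. Qed.

Lemma measurable_gamma_densityE a : measurable_fun setT (fun x : R => (gamma_density a x)%:E).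
Proof. by apply/measurable_EFinP; exact: measurable_gamma_density. Qed.

Lemma gamma_weight_int1 a : gamma_weight a setT = \int[gamma_weight a]_x cst 1 x.
Proof. by rewrite integral_cst// mul1e. Qed.

(** The functional equation of the Gamma function, obtained without integration by parts: it is
    [tilt_expectation] for S = |x| and the constant function 1. *)
Lemma gamma_weight_succ a : gamma_weight a setT < +oo ->
  gamma_weight (a + 1) setT = a%:E * gamma_weight a setT.
Proof.
move=> aoo.
have E := gamma_weight_int1; rewrite [LHS]E -gamma_weightS//.
rewrite (@tilt_expectation _ _ _ (gamma_weight a) Num.norm (cst 1) a)//.
- by rewrite -E.
- by rewrite -E.
- by move=> c c0; rewrite gamma_weight_scale.
Qed.

Lemma gamma_weight1_lty : gamma_weight (1 : R) setT < +oo.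
Proof.
rewrite gamma_weightTE; apply: (@le_lt_trans _ _ (\int[mu]_x (exponential_pdf 1 x)%:E)).
  apply: ge0_le_integral => //.
  - by move=> x _; rewrite lee_fin gamma_density_ge0.
  - exact: measurable_gamma_densityE.
  - by apply/measurable_EFinP; exact: measurable_exponential_pdf.
  move=> x _; rewrite lee_fin gamma_densityE; case: ifPn => [x0|_].
    by rewrite exponential_pdfE ?(ltW x0)// subrr powRr0 mul1r mul1r mulN1r.
  exact: exponential_pdf_ge0.
by rewrite integral_exponential_pdf// ltry.
Qed.

Lemma gamma_weight_nat_lty n : gamma_weight (n.+1%:R : R) setT < +oo.
Proof.
elim: n => [|n IH]; first exact: gamma_weight1_lty.
by rewrite -natr1 gamma_weight_succ// lte_mul_pinfty.
Qed.

(** For an integer n > a, x^(a - 1) is at most 1 on (0, 1] and at most x^n beyond, so the density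
    lies below the sum of those with parameters 1 and n + 1. *)
Lemma gamma_weight_ge1_lty a : (1 <= a)%R -> gamma_weight a setT < +oo.
Proof.
move=> a1; pose n := Num.bound a.
have an : (a < n%:R)%R by apply: archi_boundP; rewrite (le_trans ler01).
apply: (@le_lt_trans _ _ (gamma_weight (1%:R : R) setT + gamma_weight (n.+1%:R : R) setT)).
  rewrite !gamma_weightTE -ge0_integralD//; last 4 first.
  - by move=> x _; rewrite lee_fin gamma_density_ge0.
  - exact: measurable_gamma_densityE.
  - by move=> x _; rewrite lee_fin gamma_density_ge0.
  - exact: measurable_gamma_densityE.
  apply: ge0_le_integral => //.
  - by move=> x _; rewrite lee_fin gamma_density_ge0.
  - exact: measurable_gamma_densityE.
  - by apply: emeasurable_funD; exact: measurable_gamma_densityE.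
  move=> x _; rewrite -EFinD lee_fin !gamma_densityE; case: ifPn => [x0|_]; last by rewrite addr0.
  rewrite -mulrDl ler_wpM2r ?expR_ge0// subrr powRr0 -natr1 addrK.
  have [x1|/ltW x1] := leP x 1%R.
    rewrite (@le_trans _ _ 1%R) ?lerDl ?powR_ge0//.
    have : (x `^ (a - 1) <= 1 `^ (a - 1))%R.
      by apply: ge0_ler_powR; rewrite ?nnegrE ?subr_ge0// ltW.
    by rewrite powR1.
  rewrite (@le_trans _ _ (x `^ n%:R)%R) ?lerDr//.
  by apply: ler_powR => //; rewrite (le_trans _ (ltW an))// gerBl.
by rewrite lte_add_pinfty// ?gamma_weight1_lty ?gamma_weight_nat_lty.
Qed.

(** When a < 1 the density is unbounded near 0. Let G(e) be the mass of (e, +oo), finite because the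
    indicator is at most x / e. From 1 <= x + e^(-x) and the scaling identity at c = 2 one gets G(e)
    <= Gamma(a + 1) + 2^(-a) G(e), hence a bound on G(e) that does not depend on e. *)
Lemma gamma_weight_lty a : (0 < a)%R -> gamma_weight a setT < +oo.
Proof.
move=> a0.
have G1 : gamma_weight (a + 1) setT < +oo by apply: gamma_weight_ge1_lty; rewrite lerDr ltW.
have G1E : gamma_weight (a + 1) setT = \int[gamma_weight a]_x `|x|%:E.
  rewrite gamma_weight_int1 -gamma_weightS//.
  by apply: eq_integral => x _; rewrite mule1.
have mn : measurable_fun [set: R] (fun x : R => `|x|%:E).
  by apply/measurable_EFinP; exact: normr_measurable.
pose A (e : R) : set R := `]e, +oo[%classic.
have mA e : measurable (A e) by exact: measurable_itv.
have mI (e : R) : measurable_fun [set: R] (fun x : R => (\1_(A e) x)%:E) by exact/measurable_EFinP.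
have IE e x : (\1_(A e) x = (e < x)%R%:R :> R)%R by rewrite indicE /A mem_setE in_itv/= andbT.
have tailE e : gamma_weight a (A e) = \int[gamma_weight a]_x (\1_(A e) x)%:E.
  by rewrite integral_indic// setIT.
have tail_lty e : (0 < e)%R -> gamma_weight a (A e) < +oo.
  move=> e0; apply: (@le_lt_trans _ _ ((e^-1)%:E * gamma_weight (a + 1) setT)); last first.
    by rewrite lte_mul_pinfty// lee_fin invr_ge0 ltW.
  rewrite G1E -ge0_integralZl//; last by rewrite lee_fin invr_ge0 ltW.
  rewrite tailE; apply: ge0_le_integral => //; first exact: measurable_funeM.
  move=> x _; rewrite IE lee_fin; case: ltP => [ex|_]; last first.
    by rewrite mulr_ge0// invr_ge0 ltW.
  by rewrite -[true%:R]/(1 : R)%R ler_pdivlMl// mulr1 (le_trans (ltW ex))// ler_norm.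
have q1 : (2 `^ (- a) < 1 :> R)%R.
  have : (1 `^ a < 2 `^ a :> R)%R by rewrite gt0_ltr_powR ?nnegrE ?ler0n ?ltr1n.
  by rewrite powR1 powRN invf_lt1 ?powR_gt0.
(* Rescaling turns the indicator of x > e into that of x / 2 > e, which is smaller; finiteness of
   the tail then allows solving the inequality for it. *)
have tail_le e : (0 < e)%R ->
    gamma_weight a (A e) <= (fine (gamma_weight (a + 1) setT) / (1 - 2 `^ (- a)))%:E.
  move=> e0.
  have H : gamma_weight a (A e) <=
      gamma_weight (a + 1) setT + (2 `^ (- a))%:E * gamma_weight a (A e).
    apply: (@le_trans _ _ (gamma_weight (a + 1) setT +
        (2 `^ (- a))%:E * \int[gamma_weight a]_x (\1_(A e) (x / 2)%R)%:E)).
      rewrite -(@gamma_weight_scale _ a 2 (fun x => (\1_(A e) x)%:E))// G1E -ge0_integralD//.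
      - rewrite tailE; apply: ge0_le_integral => //.
        + apply: emeasurable_funD => //; apply: emeasurable_funM => //.
          apply/measurable_EFinP; apply: measurableT_comp => //.
          by apply: measurable_funM => //; exact: normr_measurable.
        + move=> x _; rewrite -EFinM -EFinD lee_fin IE; case: ltP => _.
            by rewrite -[true%:R]/(1 : R)%R; have := expR_ge1Dx ((1 - 2) * `|x|); lra.
          by rewrite mul0r addr0 normr_ge0.
      - apply: emeasurable_funM => //.
        apply/measurable_EFinP; apply: measurableT_comp => //.
        by apply: measurable_funM => //; exact: normr_measurable.
    rewrite leeD2l// lee_wpmul2l ?lee_fin ?powR_ge0// tailE; apply: ge0_le_integral => //.
      have m2 : measurable_fun [set: R] (fun x : R => (x / 2)%R) by exact: measurable_funM.
      apply/measurable_EFinP; exact: (measurableT_comp (measurable_indic (mA e)) m2).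
    move=> x _; rewrite lee_fin !IE; case: ltP => // ex2; case: ltP => // xe.
    by move: ex2 e0 xe; rewrite ltr_pdivlMr//; lra.
  have Tfin : gamma_weight a (A e) \is a fin_num by rewrite ge0_fin_numE ?tail_lty.
  have Gfin : gamma_weight (a + 1) setT \is a fin_num by rewrite ge0_fin_numE.
  move: H; rewrite -(fineK Tfin) -(fineK Gfin) -EFinM -EFinD !lee_fin => H.
  by rewrite /= ler_pdivlMr ?subr_gt0// mulrBr mulr1 lerBlDr [X in (_ + X)%R]mulrC.
pose F n := A (n.+1%:R^-1)%R.
have UF : \bigcup_n F n = A 0%R.
  apply/seteqP; split => x; rewrite /F /A /=.
    by move=> [n _] /=; rewrite !in_itv/= !andbT; apply: lt_trans; rewrite invr_gt0.
  rewrite in_itv/= andbT => x0; exists (Num.bound x^-1)%R => //=; rewrite in_itv/= andbT.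
  rewrite -[ltRHS]invrK ltf_pV2 ?posrE ?invr_gt0// -natr1 ltr_wpDr//.
  by apply: archi_boundP; rewrite invr_ge0 ltW.
have ndF : nondecreasing_seq F.
  move=> i j ij; apply/subsetPset => x; rewrite /F /A/= !in_itv/= !andbT; apply: le_lt_trans.
  by rewrite lef_pV2 ?posrE// ler_nat.
have -> : gamma_weight a setT = gamma_weight a (A 0%R).
  rewrite {2}/gamma_weight integral_mkcond; apply: eq_integral => x _.
  by rewrite patchE /A mem_setE in_itv/= andbT; case: ifPn => // x0; rewrite gamma_densityE (negbTE x0).
have cF : gamma_weight a (F n) @[n --> \oo] --> gamma_weight a (A 0%R).
  by rewrite -UF; apply: nondecreasing_cvg_mu => // [n|]; [exact: mA|rewrite UF; exact: mA].
apply: le_lt_trans (ltry (fine (gamma_weight (a + 1) setT) / (1 - 2 `^ (- a)))).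
rewrite -(cvg_lim _ cF)//; apply: lime_le; first by apply/cvg_ex; eexists; exact: cF.
by apply: nearW => n; apply: tail_le; rewrite invr_gt0.
Qed.

Lemma gamma_weight_gt0 a : (0 < a)%R -> 0 < gamma_weight a setT.
Proof.
(* On [1, 2], x^(a - 1) = x^a / x >= 1/2 and e^(-x) >= e^(-2). *)
move=> a0; apply: (@lt_le_trans _ _ (\int[mu]_(x in `[1%R, 2%R]) (expR (- 2) / 2)%:E)).
  rewrite integral_cst//= lebesgue_measure_itv/= lte_fin ltr1n -EFinB -EFinM lte_fin.
  by rewrite mulr_gt0 ?divr_gt0 ?expR_gt0//; lra.
rewrite gamma_weightTE integral_mkcond; apply: ge0_le_integral => //.
- by move=> x _; rewrite patchE; case: ifPn => // _; rewrite lee_fin divr_ge0 ?expR_ge0.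
- exact/measurable_restrict.
- exact: measurable_gamma_densityE.
move=> x _; rewrite patchE mem_setE in_itv/=; case: ifPn => [/andP[x1 x2]|_]; last first.
  by rewrite lee_fin gamma_density_ge0.
have x0 : (0 < x)%R by rewrite (lt_le_trans _ x1).
rewrite lee_fin gamma_densityE x0 mulrC ler_pM// ?expR_ge0 ?invr_ge0//; last first.
  by rewrite ler_expR lerN2.
have H : (x `^ a = x `^ (a - 1) * x)%R.
  by rewrite -[X in (_ * X)%R](powRr1 (ltW x0)) -powRD ?subrK ?(gt_eqF x0) ?implybT.
have : (1 <= x `^ a)%R.
  have : (1 `^ a <= x `^ a)%R by apply: ge0_ler_powR; rewrite ?nnegrE// ltW.
  by rewrite powR1.
rewrite H => H1; rewrite -(@ler_pM2r _ x)// (le_trans _ H1)//; lra.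
Qed.

End gamma_mass.

Section gamma_law_identities.
Context {R : realType}.
Local Open Scope ereal_scope.
Implicit Types (a : R) (f : R -> \bar R).

Lemma ge0_integral_gamma_law a f : (0 < a)%R ->
  measurable_fun setT f -> (forall x, 0 <= f x) ->
  \int[gamma_law a]_x f x =
  ((fine (gamma_weight a setT))^-1)%:E * \int[gamma_weight a]_x f x.
Proof.
move=> a0 mf f0; rewrite /gamma_law a0.
have G0 := gamma_weight_gt0 a0; have Goo := gamma_weight_lty a0.
have k0 : (0 <= (fine (gamma_weight a setT))^-1)%R by rewrite invr_ge0 fine_ge0 ?ltW.
rewrite -[((fine _)^-1)%:E]/((NngNum k0)%:num%:E) -ge0_integral_mscale//.
apply: eq_measure_integral => A mA _.
by rewrite /= /mnormalize /mscale/= gt_eqF// lt_eqF//= muleC.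
Qed.

Lemma integral_gamma_law0 f : measurable_fun setT f -> \int[gamma_law (0 : R)]_x f x = f 0%R.
Proof. by move=> mf; rewrite /gamma_law ltxx integral_dirac// diracT mul1e. Qed.

Lemma eq_integral_gamma_law a f g : (0 <= a)%R ->
  measurable_fun setT f -> (forall x, 0 <= f x) ->
  measurable_fun setT g -> (forall x, 0 <= g x) -> (forall x, 0 <= x -> f x = g x)%R ->
  \int[gamma_law a]_x f x = \int[gamma_law a]_x g x.
Proof.
rewrite le_eqVlt => /predU1P[<-|a0] mf f0 mg g0 fg.
  by rewrite !integral_gamma_law0// fg.
by rewrite !ge0_integral_gamma_law//; congr (_ * _); exact: eq_integral_gamma_weight.
Qed.

(** At a = 0 the law is the Dirac mass at 0 and both sides reduce to f 0; cells of zero mass are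
    thus covered. *)
Lemma gamma_law_scale a c f : (0 <= a)%R -> (0 < c)%R ->
  measurable_fun setT f -> (forall x, 0 <= f x) ->
  \int[gamma_law a]_x (f x * (expR ((1 - c) * `|x|))%:E) =
  (c `^ (- a))%:E * \int[gamma_law a]_x f (x / c)%R.
Proof.
move=> a0 c0 mf f0.
have mdiv : measurable_fun [set: R] (fun x : R => x / c)%R by exact: measurable_funM.
have mfdiv : measurable_fun [set: R] (fun x : R => f (x / c)%R) by exact: measurableT_comp.
have mexp : measurable_fun [set: R] (fun x : R => (expR ((1 - c) * `|x|))%:E).
  by apply/measurable_EFinP; apply: measurableT_comp => //; exact: measurable_funM.
have mfexp : measurable_fun [set: R] (fun x : R => f x * (expR ((1 - c) * `|x|))%:E).
  exact: emeasurable_funM.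
move: a0; rewrite le_eqVlt => /predU1P[<-|a0].
  by rewrite !integral_gamma_law0// mul0r normr0 mulr0 expR0 mule1 oppr0 powRr0 mul1e.
rewrite !ge0_integral_gamma_law//; first by rewrite gamma_weight_scale// muleCA.
by move=> x; rewrite mule_ge0// lee_fin expR_ge0.
Qed.

Lemma gamma_lawS a f : (0 <= a)%R ->
  measurable_fun setT f -> (forall x, 0 <= f x) ->
  \int[gamma_law a]_x (`|x|%:E * f x) = a%:E * \int[gamma_law (a + 1)]_x f x.
Proof.
move=> a0 mf f0.
have mn : measurable_fun [set: R] (fun x : R => `|x|%:E).
  by apply/measurable_EFinP; exact: normr_measurable.
have mnf : measurable_fun [set: R] (fun x : R => `|x|%:E * f x) by exact: emeasurable_funM.
move: a0; rewrite le_eqVlt => /predU1P[<-|a0].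
  by rewrite [LHS](integral_gamma_law0 mnf) normr0 !mul0e.
have nf0 x : 0 <= `|x|%:E * f x by rewrite mule_ge0.
have G0 := gamma_weight_gt0 a0; have Goo := gamma_weight_lty a0.
have a10 : (0 < a + 1)%R by rewrite addr_gt0.
rewrite [LHS](ge0_integral_gamma_law a0 mnf nf0).
rewrite [X in _ = _ * X](ge0_integral_gamma_law a10 mf f0).
rewrite [X in _ * X = _](gamma_weightS _ mf f0) [X in _ = _ * (((fine X)^-1)%:E * _)]gamma_weight_succ// muleA -EFinM fineM//; last first.
  by rewrite ge0_fin_numE// ltW.
congr (_%:E * _); rewrite /= invfM mulrA divff ?mul1r// gt_eqF//.
Qed.

End gamma_law_identities.

(** * Vectors of independent Gamma variables *)

Section tuple_product_integral.
Context d (T : measurableType d) (R : realType).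
Local Open Scope ereal_scope.

Lemma integral_tuple_product0 (P : 'I_0 -> probability T R) (f : 0.-tuple T -> \bar R) :
  measurable_fun setT f -> \int[tuple_product P]_z f z = f [tuple].
Proof. by move=> mf; rewrite /= integral_dirac// diracT mul1e. Qed.

Lemma measurable_tcons_section n (x : T) : measurable_fun [set: n.-tuple T] (fun z => tcons (x, z)).
Proof. apply: measurableT_comp => //; exact: measurable_tcons. Qed.

Lemma integral_tuple_productS n (P : 'I_n.+1 -> probability T R) (f : n.+1.-tuple T -> \bar R) :
  measurable_fun setT f -> (forall z, 0 <= f z) ->
  \int[tuple_product P]_z f z =
  \int[P ord0]_x \int[tuple_product (fun i => P (lift ord0 i))]_z f (tcons (x, z)).
Proof.
move=> mf f0; rewrite /=.
rewrite ge0_integral_distribution// fubini_tonelli1//.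
  by apply: measurableT_comp => //; exact: measurable_tcons.
by move=> x; exact: f0.
Qed.

Lemma tnth_tcons0 n (x : T) (z : n.-tuple T) : tnth (tcons (x, z)) ord0 = x.
Proof. by []. Qed.

Lemma tnth_tconsS n (x : T) (z : n.-tuple T) i : tnth (tcons (x, z)) (lift ord0 i) = tnth z i.
Proof. by rewrite !(tnth_nth x). Qed.

End tuple_product_integral.

Section gamma_product.
Context {R : realType}.
Local Open Scope ereal_scope.

Definition gamma_product k (b : 'I_k -> R) : probability (k.-tuple R) R :=
  tuple_product (fun j => gamma_law (b j)).

Definition tuple_div k (c : R) (z : k.-tuple R) : k.-tuple R :=
  [tuple (tnth z j / c)%R | j < k].

(** The total S in a form that is nonnegative on all tuples; it is the plain sum on tuples with
    nonnegative coordinates. *)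
Definition abs_sum k (z : k.-tuple R) : R := (\sum_(j < k) `|tnth z j|)%R.

Definition incr k (b : 'I_k -> R) (j : 'I_k) : 'I_k -> R :=
  fun i => (b i + (i == j)%:R)%R.

Lemma measurable_tuple_div k c : measurable_fun setT (@tuple_div k c).
Proof.
apply/measurable_fun_tnthP => j.
rewrite (_ : _ \o _ = (fun z => tnth z j / c)%R); last first.
  by apply/funext => z; rewrite /= tnth_mktuple.
by apply: measurable_funM => //; exact: measurable_tnth.
Qed.

Lemma measurable_abs_sum k : measurable_fun setT (@abs_sum k).
Proof.
apply: measurable_sum => j; apply: measurableT_comp => //; exact: measurable_tnth.
Qed.

Lemma abs_sum_ge0 k (z : k.-tuple R) : (0 <= abs_sum z)%R.
Proof. exact: sumr_ge0. Qed.

Lemma tuple_div_tcons k c (x : R) (z : k.-tuple R) :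
  tuple_div c (tcons (x, z)) = tcons ((x / c)%R, tuple_div c z).
Proof.
apply: eq_from_tnth => j; rewrite tnth_mktuple.
have [i|] := unliftP ord0 j => ->; first by rewrite !tnth_tconsS tnth_mktuple.
by rewrite !tnth_tcons0.
Qed.

Lemma abs_sum_tcons k (x : R) (z : k.-tuple R) :
  abs_sum (tcons (x, z)) = (`|x| + abs_sum z)%R.
Proof.
rewrite /abs_sum big_ord_recl tnth_tcons0; congr (_ + _)%R.
by apply: eq_bigr => j _; rewrite tnth_tconsS.
Qed.

Lemma measurable_tcons_integral k (Q : probability (k.-tuple R) R)
    (f : k.+1.-tuple R -> \bar R) : measurable_fun setT f -> (forall z, 0 <= f z) ->
  measurable_fun setT (fun x => \int[Q]_z f (tcons (x, z))).
Proof.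
move=> mf f0.
apply: (@measurable_fun_fubini_tonelli_F _ _ _ _ R Q (f \o (@tcons _ R k))).
  by apply: measurableT_comp => //; exact: measurable_tcons.
by move=> x; exact: f0.
Qed.

Lemma measurable_tcons_r k (f : k.+1.-tuple R -> \bar R) (x : R) : measurable_fun setT f ->
  measurable_fun setT (fun z : k.-tuple R => f (tcons (x, z))).
Proof. by move=> mf; apply: measurableT_comp => //; exact: measurable_tcons_section. Qed.

Lemma integral_gamma_productS k (b : 'I_k.+1 -> R) (f : k.+1.-tuple R -> \bar R) :
  measurable_fun setT f -> (forall z, 0 <= f z) ->
  \int[gamma_product b]_z f z =
  \int[gamma_law (b ord0)]_x \int[gamma_product (fun i => b (lift ord0 i))]_z f (tcons (x, z)).
Proof. exact: integral_tuple_productS. Qed.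

Lemma incr_lift_lift k (b : 'I_k.+1 -> R) (i : 'I_k) :
  (fun l => incr b (lift ord0 i) (lift ord0 l)) = incr (fun l => b (lift ord0 l)) i.
Proof. by apply/funext => l; rewrite /incr (inj_eq lift_inj). Qed.

Lemma incr_lift0 k (b : 'I_k.+1 -> R) :
  (fun l => incr b ord0 (lift ord0 l)) = (fun l => b (lift ord0 l)).
Proof. by apply/funext => l; rewrite /incr addr0. Qed.

(** The Gamma laws do not charge the negative half-line. This is what allows absolute values and
    truncations to be inserted into integrands and removed again. *)
Lemma eq_integral_gamma_product k (b : 'I_k -> R) (f g : k.-tuple R -> \bar R) :
  (forall j, 0 <= b j)%R ->
  measurable_fun setT f -> (forall z, 0 <= f z) ->
  measurable_fun setT g -> (forall z, 0 <= g z) ->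
  (forall z, (forall j, 0 <= tnth z j)%R -> f z = g z) ->
  \int[gamma_product b]_z f z = \int[gamma_product b]_z g z.
Proof.
elim: k b f g => [|k IH] b f g b0 mf f0 mg g0 fg.
  by rewrite !integral_tuple_product0// fg// => -[].
rewrite [LHS](integral_gamma_productS _ mf f0) [RHS](integral_gamma_productS _ mg g0).
apply: eq_integral_gamma_law; first exact: b0.
- exact: measurable_tcons_integral.
- by move=> x; apply: integral_ge0.
- exact: measurable_tcons_integral.
- by move=> x; apply: integral_ge0.
move=> x x0; apply: (IH (fun i => b (lift ord0 i))) => //; [exact: measurable_tcons_r|exact: measurable_tcons_r|].
move=> z z0; apply: fg => j.
by have [i|] := unliftP ord0 j => ->; rewrite ?tnth_tconsS// tnth_tcons0.
Qed.

(** The exponential of the sum factors over the independent coordinates, and the one-dimensional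
    identity contributes one factor c^(-b_j) for each. *)
Lemma gamma_product_scale k (b : 'I_k -> R) c (f : k.-tuple R -> \bar R) :
  (forall j, 0 <= b j)%R -> (0 < c)%R ->
  measurable_fun setT f -> (forall z, 0 <= f z) ->
  \int[gamma_product b]_z (f z * (expR ((1 - c) * abs_sum z))%:E) =
  (c `^ (- \sum_(j < k) b j))%:E * \int[gamma_product b]_z f (tuple_div c z).
Proof.
move=> b0 c0.
have mexp n : measurable_fun setT (fun z : n.-tuple R => (expR ((1 - c) * abs_sum z))%:E).
  apply/measurable_EFinP; apply: measurableT_comp => //; apply: measurable_funM => //.
  exact: measurable_abs_sum.
elim: k b f b0 => [|k IH] b f b0 mf f0.
  rewrite !integral_tuple_product0//.
  - rewrite big_ord0 oppr0 powRr0 mul1e /abs_sum big_ord0 mulr0 expR0 mule1.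
    by rewrite (tuple0 (tuple_div c _)).
  - by apply: measurableT_comp => //; exact: measurable_tuple_div.
  - exact: (emeasurable_funM mf (mexp 0%N)).
pose b' i := b (lift ord0 i).
have mfd n (h : n.-tuple R -> \bar R) : measurable_fun setT h ->
    measurable_fun setT (fun z => h (tuple_div c z)).
  by move=> mh; apply: measurableT_comp => //; exact: measurable_tuple_div.
have mfe : measurable_fun setT (fun z => f z * (expR ((1 - c) * abs_sum z))%:E).
  exact: (emeasurable_funM mf (mexp k.+1)).
have fe0 z : 0 <= f z * (expR ((1 - c) * abs_sum z))%:E.
  by rewrite mule_ge0// lee_fin expR_ge0.
rewrite [LHS](integral_gamma_productS _ mfe fe0).
rewrite [X in _ = _ * X](integral_gamma_productS _ (mfd _ _ mf))//.
pose F x := \int[gamma_product b']_z f (tcons (x, tuple_div c z)).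
have mF : measurable_fun setT F.
  rewrite /F; apply: (@measurable_fun_fubini_tonelli_F _ _ _ _ R (gamma_product b')
    (fun p => f (tcons (p.1, tuple_div c p.2)))) => //.
  have m1 : measurable_fun setT (fun p : R * k.-tuple R => (p.1, tuple_div c p.2)).
    apply: measurable_fun_pair => //; apply: measurableT_comp => //.
    exact: measurable_tuple_div.
  have m2 : measurable_fun setT (fun p : R * k.-tuple R => tcons (p.1, tuple_div c p.2)).
    by apply: measurableT_comp m1; exact: measurable_tcons.
  exact: measurableT_comp mf m2.
have F0 x : 0 <= F x by apply: integral_ge0.
transitivity (\int[gamma_law (b ord0)]_x ((c `^ (- \sum_(j < k) b' j))%:E *
    (F x * (expR ((1 - c) * `|x|))%:E))).
  apply: eq_integral => x _; rewrite muleA.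
  rewrite -(IH b' _ (fun j => b0 _) (measurable_tcons_r x mf) (fun z => f0 _)).
  rewrite -(ge0_integralZr _ measurableT (emeasurable_funM (measurable_tcons_r x mf) (mexp k))).
  - apply: eq_integral => z _.
    by rewrite abs_sum_tcons mulrDr expRD EFinM muleA muleAC.
  - by move=> z _; rewrite mule_ge0// lee_fin expR_ge0.
  - by rewrite lee_fin expR_ge0.
rewrite ge0_integralZl//; last 3 first.
- apply: emeasurable_funM => //; apply/measurable_EFinP; apply: measurableT_comp => //.
  exact: measurable_funM.
- by move=> x _; rewrite mule_ge0// lee_fin expR_ge0.
- by rewrite lee_fin powR_ge0.
rewrite (gamma_law_scale (b0 ord0) c0 mF F0) muleA -EFinM.
have -> : (c `^ (- \sum_(j < k) b' j) * c `^ (- b ord0) = c `^ (- \sum_(j < k.+1) b j))%R.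
  by rewrite -powRD ?(gt_eqF c0) ?implybT// big_ord_recl opprD addrC.
congr (_ * _).
by apply: eq_integral => x _; apply: eq_integral => z _; rewrite tuple_div_tcons.
Qed.

Lemma gamma_productS k (b : 'I_k -> R) j (f : k.-tuple R -> \bar R) :
  (forall i, 0 <= b i)%R -> measurable_fun setT f -> (forall z, 0 <= f z) ->
  \int[gamma_product b]_z (`|tnth z j|%:E * f z) =
  (b j)%:E * \int[gamma_product (incr b j)]_z f z.
Proof.
elim: k b j f => [|k IH] b j f b0 mf f0; first by case: j.
have mn i : measurable_fun setT (fun z : k.+1.-tuple R => `|tnth z i|%:E).
  by apply/measurable_EFinP; apply: measurableT_comp => //; exact: measurable_tnth.
have mnf : measurable_fun setT (fun z : k.+1.-tuple R => `|tnth z j|%:E * f z).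
  exact: (emeasurable_funM (mn j) mf).
have nf0 (z : k.+1.-tuple R) : 0 <= `|tnth z j|%:E * f z by rewrite mule_ge0.
rewrite [LHS](integral_gamma_productS _ mnf nf0).
rewrite [X in _ = _ * X](integral_gamma_productS _ mf f0).
have [i ->|->] := unliftP ord0 j.
  transitivity (\int[gamma_law (b ord0)]_x ((b (lift ord0 i))%:E *
     \int[gamma_product (incr (fun l => b (lift ord0 l)) i)]_z f (tcons (x, z)))).
    apply: eq_integral => x _.
    rewrite -(IH (fun l => b (lift ord0 l)) i (fun z => f (tcons (x, z))))//; last first.
      exact: measurable_tcons_r.
    by apply: eq_integral => z _; rewrite tnth_tconsS.
  rewrite [LHS](ge0_integralZl (gamma_law (b ord0)) measurableT (measurable_tcons_integral _ mf f0)); last 2 first.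
  - by move=> x _; apply: integral_ge0 => z _; exact: f0.
  - by rewrite lee_fin.
  have -> : incr b (lift ord0 i) ord0 = b ord0 by rewrite /incr addr0.
  by rewrite incr_lift_lift.
transitivity (\int[gamma_law (b ord0)]_x (`|x|%:E *
   \int[gamma_product (fun l => b (lift ord0 l))]_z f (tcons (x, z)))).
  apply: eq_integral => x _; rewrite -ge0_integralZl//.
  - exact: measurable_tcons_r.
have -> : incr b ord0 ord0 = (b ord0 + 1)%R by rewrite /incr eqxx.
rewrite incr_lift0; apply: gamma_lawS; first exact: b0.
- exact: measurable_tcons_integral.
- by move=> x; apply: integral_ge0.
Qed.

End gamma_product.

(** * Dirichlet distributions *)

Section dirichlet_identities.
Context {R : realType}.
Local Open Scope ereal_scope.

(** 1 / x is x times a real power of x^2 >= 0, so measurability of powers suffices; at 0 both sides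
    are 0 by the convention for inverses. *)
Lemma measurable_invr : measurable_fun [set: R] (@GRing.inv R).
Proof.
rewrite (_ : @GRing.inv R = (fun x => x * (x ^+ 2) `^ (-1))%R); last first.
  apply/funext => x; rewrite powR_inv1 ?sqr_ge0//.
  have [->|x0] := eqVneq x 0%R; first by rewrite invr0 mul0r.
  by rewrite expr2 invfM mulrA divff// mul1r.
apply: measurable_funM => //.
have m2 : measurable_fun [set: R] (fun x : R => x ^+ 2)%R by exact: measurable_funX.
exact: (measurableT_comp (@measurable_powR R (-1)) m2).
Qed.

Definition tuple_normalize k (z : k.-tuple R) : k.-tuple R :=
  [tuple (tnth z j / \sum_(i < k) tnth z i)%R | j < k].

Lemma measurable_tuple_normalize k : measurable_fun setT (@tuple_normalize k).
Proof.
apply/measurable_fun_tnthP => j.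
rewrite (_ : _ \o _ = (fun z : k.-tuple R => tnth z j / \sum_(i < k) tnth z i)%R); last first.
  by apply/funext => z; rewrite /= tnth_mktuple.
apply: measurable_funM; first exact: measurable_tnth.
apply: (measurableT_comp measurable_invr); apply: measurable_sum => i.
exact: measurable_tnth.
Qed.

Lemma tuple_normalize_div k c (z : k.-tuple R) : (0 < c)%R ->
  tuple_normalize (tuple_div c z) = tuple_normalize z.
Proof.
move=> c0; apply: eq_from_tnth => j; rewrite !tnth_mktuple.
under eq_bigr do rewrite tnth_mktuple.
rewrite -mulr_suml invfM invrK mulrA [(_ / c * _)%R]mulrAC [(_ / c * _)%R]mulrAC -mulrA.
by rewrite divff ?mulr1// gt_eqF.
Qed.

Definition dirichlet_expect k (b : 'I_k -> R) (f : k.-tuple R -> \bar R) : \bar R :=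
  \int[gamma_product b]_z f (tuple_normalize z).

Lemma dirichlet_expect_indic k (b : 'I_k -> R) (B : set (k.-tuple R)) : measurable B ->
  dirichlet_expect b (EFin \o \1_B) = dirichlet_distribution b B.
Proof.
move=> mB; rewrite /dirichlet_expect.
rewrite -[LHS]/(\int[gamma_product b]_z ((\1_B \o @tuple_normalize k) z)%:E).
rewrite (_ : \1_B \o _ = \1_(@tuple_normalize k @^-1` B)); last first.
  by apply/funext => z; rewrite /= !indicE.
have mnB : measurable (@tuple_normalize k @^-1` B).
  by rewrite -[X in measurable X]setTI; exact: measurable_tuple_normalize.
by rewrite integral_indic// setIT.
Qed.

Lemma measurable_normalize_comp k (f : k.-tuple R -> \bar R) :
  measurable_fun setT f -> measurable_fun setT (f \o @tuple_normalize k).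
Proof. by move=> mf; apply: measurableT_comp => //; exact: measurable_tuple_normalize. Qed.

(** Normalization is invariant under scaling, so the tilt acts on f (Z / S) only through the factor
    c^(- sum_j b_j). The result is the first-moment form of the independence of S and Z / S. *)
Lemma abs_sum_dirichlet k (b : 'I_k -> R) (f : k.-tuple R -> \bar R) :
  (forall j, 0 <= b j)%R -> measurable_fun setT f -> (forall v, 0 <= f v) ->
  dirichlet_expect b f < +oo ->
  \int[gamma_product b]_z ((abs_sum z)%:E * f (tuple_normalize z)) =
  (\sum_(j < k) b j)%:E * dirichlet_expect b f.
Proof.
move=> b0 mf f0 foo.
have mnf := measurable_normalize_comp mf.
apply: (tilt_expectation (measurable_abs_sum (k := k)) (@abs_sum_ge0 R k) mnf) => //.
  by move=> z; exact: f0.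
move=> c c0; rewrite (gamma_product_scale b0 c0 mnf)//; last by move=> z; exact: f0.
by congr (_ * _); apply: eq_integral => z _; rewrite /= tuple_normalize_div.
Qed.

Lemma ge0_tnth_sum k (z : k.-tuple R) : (forall j, 0 <= tnth z j)%R ->
  (\sum_(j < k) tnth z j = abs_sum z)%R.
Proof. by move=> z0; apply: eq_bigr => j _; rewrite ger0_norm. Qed.

Lemma tnth_normalize_le1 k (z : k.-tuple R) j : (forall j, 0 <= tnth z j)%R ->
  (`|tnth (tuple_normalize z) j| <= 1)%R.
Proof.
move=> z0; rewrite tnth_mktuple ge0_tnth_sum// normrM normfV (ger0_norm (abs_sum_ge0 z)).
have := abs_sum_ge0 z; rewrite le_eqVlt => /predU1P[<-|S0].
  by rewrite invr0 mulr0.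
by rewrite ler_pdivrMr// mul1r /abs_sum (bigD1 j)//= lerDl sumr_ge0.
Qed.

(* Size-biasing a coordinate of a Dirichlet vector increments its parameter. *)
Lemma dirichlet_expect_coord k (b : 'I_k -> R) j (f : k.-tuple R -> \bar R) :
  (forall i, 0 <= b i)%R -> measurable_fun setT f -> (forall v, 0 <= f v) ->
  dirichlet_expect b f < +oo ->
  (\sum_(i < k) b i)%:E * dirichlet_expect b (fun v => `|tnth v j|%:E * f v) =
  (b j)%:E * dirichlet_expect (incr b j) f.
Proof.
move=> b0 mf f0 foo.
have mtn : measurable_fun setT (fun v : k.-tuple R => `|tnth v j|%:E).
  by apply/measurable_EFinP; apply: measurableT_comp => //; exact: measurable_tnth.
have mtf : measurable_fun setT (fun v : k.-tuple R => `|tnth v j|%:E * f v).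
  exact: (emeasurable_funM mtn mf).
have tf0 (v : k.-tuple R) : 0 <= `|tnth v j|%:E * f v by rewrite mule_ge0.
have mnf := measurable_normalize_comp mf.
have mntf := measurable_normalize_comp mtf.
rewrite -abs_sum_dirichlet//; last first.
  apply: le_lt_trans foo; rewrite /dirichlet_expect.
  (* Off the simplex [|tnth v j|] is unbounded; truncating it at 1 changes nothing on normalized
     nonnegative tuples and gives an integrand below f everywhere. *)
  pose g (v : k.-tuple R) := (Num.min `|tnth v j| 1)%:E * f v.
  have mg : measurable_fun setT g.
    apply: emeasurable_funM => //; apply/measurable_EFinP; apply: measurable_minr => //.
    by apply: measurableT_comp => //; exact: measurable_tnth.
  have g0 v : 0 <= g v by rewrite mule_ge0// lee_fin le_min normr_ge0 ler01.
  have mng := measurable_normalize_comp mg.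
  rewrite (eq_integral_gamma_product b0 mntf _ mng)//.
  - apply: ge0_le_integral => //.
    + by move=> z _; exact: g0.
    + by move=> z _; rewrite /g /= -[leRHS]mul1e lee_wpmul2r// lee_fin ge_min lexx orbT.
  - by move=> z; exact: tf0.
  - by move=> z; exact: g0.
  - by move=> z z0; rewrite /g/= min_l// tnth_normalize_le1.
rewrite /dirichlet_expect -(gamma_productS j b0 mnf); last by move=> z; exact: f0.
apply: eq_integral_gamma_product => //.
- apply: (emeasurable_funM _ mntf); apply/measurable_EFinP; exact: measurable_abs_sum.
- by move=> z; rewrite mule_ge0// lee_fin abs_sum_ge0.
- exact: (emeasurable_funM mtn mnf).
- by move=> z; rewrite mule_ge0//; exact: f0.
move=> z z0; rewrite muleA -EFinM; congr (_%:E * _).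
rewrite tnth_mktuple ge0_tnth_sum// normrM normfV (ger0_norm (abs_sum_ge0 z)) mulrCA.
(* S times the normalized coordinate is z_j; if S = 0, division by 0 returns 0, but z_j is then 0 as
   well. *)
have [S0|S0] := eqVneq (abs_sum z) 0%R; last by rewrite divff ?mulr1.
rewrite S0 mul0r mulr0; apply/esym/eqP; rewrite -normr_le0 normr_id -S0 /abs_sum.
by rewrite (bigD1 j)//= lerDl sumr_ge0.
Qed.

(** S is expanded as the sum of the |Z_j| inside E[S f(Z / S)]. The relation that normalized
    coordinates sum to 1 is avoided, since it fails where S = 0. *)
Lemma dirichlet_expect_incr k (b : 'I_k -> R) (f : k.-tuple R -> \bar R) :
  (forall i, 0 <= b i)%R -> measurable_fun setT f -> (forall v, 0 <= f v) ->
  dirichlet_expect b f < +oo ->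
  (\sum_(i < k) b i)%:E * dirichlet_expect b f =
  \sum_(j < k) (b j)%:E * dirichlet_expect (incr b j) f.
Proof.
move=> b0 mf f0 foo; have mnf := measurable_normalize_comp mf.
have mtn j : measurable_fun setT (fun v : k.-tuple R => `|tnth v j|%:E).
  by apply/measurable_EFinP; apply: measurableT_comp => //; exact: measurable_tnth.
rewrite -abs_sum_dirichlet//.
rewrite (eq_integral (fun z : k.-tuple R =>
    \sum_(j < k) `|tnth z j|%:E * f (tuple_normalize z))); last first.
  by move=> z _; rewrite /abs_sum -sumEFin ge0_sume_distrl.
rewrite ge0_integral_sum//.
- by apply: eq_bigr => j _; rewrite (gamma_productS j b0 mnf)// => z; exact: f0.
- by move=> j; exact: (emeasurable_funM (mtn j) mnf).
- by move=> j z _; rewrite mule_ge0.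
Qed.

End dirichlet_identities.

(** * Masses of the Polya urn *)

Section dirichlet_urn.
Context {R : realType}.
Local Open Scope ereal_scope.

(** The bound is asked for on coordinate sums at most 1, not equal to 1, because the zero tuple
    normalizes to itself. *)
Lemma dirichlet_expect_lty k (b : 'I_k -> R) (f : k.-tuple R -> R) (c : R) :
  (forall i, 0 <= b i)%R -> measurable_fun setT f -> (forall v, 0 <= f v)%R ->
  (forall v, (forall j, 0 <= tnth v j)%R -> (\sum_(j < k) tnth v j <= 1)%R -> f v <= c)%R ->
  dirichlet_expect b (EFin \o f) < +oo.
Proof.
move=> b0 mf f0 fc.
pose c' := Num.max c 0%R.
pose g v := (Num.min (f v) c')%:E.
have mfE : measurable_fun setT (EFin \o f) by exact/measurable_EFinP.
have mgE : measurable_fun setT g by apply/measurable_EFinP; apply: measurable_minr.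
have g0 v : 0 <= g v by rewrite lee_fin le_min f0 le_max lexx orbT.
apply: (@le_lt_trans _ _ (\int[gamma_product b]_z cst c'%:E z)).
  rewrite /dirichlet_expect.
  rewrite (eq_integral_gamma_product b0 (measurable_normalize_comp mfE) _
     (measurable_normalize_comp mgE)).
  - apply: ge0_le_integral => //.
    + by move=> z _; exact: g0.
    + exact: measurable_normalize_comp.
    + by move=> z _; rewrite /= lee_fin ge_min lexx orbT.
  - by move=> z; rewrite lee_fin.
  - by move=> z; exact: g0.
  move=> z z0; rewrite /g /= min_l// le_max fc//.
  - move=> j; rewrite tnth_mktuple divr_ge0// sumr_ge0// => i _; exact: z0.
  - under eq_bigr do rewrite tnth_mktuple.
    rewrite -mulr_suml; have [->|S0] := eqVneq (\sum_(i < k) tnth z i)%R 0%R.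
      by rewrite mul0r.
    by rewrite divff.
by rewrite integral_cst// [X in _ * X](_ : _ = 1) ?mule1 ?ltry//; exact: probability_setT.
Qed.

Lemma dirichlet_expect_cst k (b : 'I_k -> R) (x : R) :
  dirichlet_expect b (cst x%:E) = x%:E.
Proof. rewrite /dirichlet_expect integral_cst// [X in _ * X](_ : _ = 1) ?mule1//.
exact: probability_setT. Qed.

Variables (k : nat) (C : set (k.-tuple R)).
Hypothesis mC : measurable C.

Definition dirichlet_mass (b : 'I_k -> R) : R := fine (dirichlet_distribution b C).

Lemma dirichlet_massE b : dirichlet_distribution b C = (dirichlet_mass b)%:E.
Proof.
rewrite /dirichlet_mass fineK//; have mCn : measurable (@tuple_normalize R k @^-1` C).
  by rewrite -[X in measurable X]setTI; exact: measurable_tuple_normalize.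
exact: (fin_num_measure (gamma_product b) _ mCn).
Qed.

Lemma dirichlet_mass_bounds b : (0 <= dirichlet_mass b <= 1)%R.
Proof.
rewrite -!lee_fin -dirichlet_massE; have mCn : measurable (@tuple_normalize R k @^-1` C).
  by rewrite -[X in measurable X]setTI; exact: measurable_tuple_normalize.
by rewrite (measure_ge0 (gamma_product b)) (probability_le1 (gamma_product b)).
Qed.

(** The predictive identity of the urn: one draw, of colour j with probability proportional to b_j,
    leaves the expected mass of C unchanged. *)
Lemma dirichlet_mass_incr b : (forall i, 0 <= b i)%R ->
  ((\sum_(i < k) b i) * dirichlet_mass b =
   \sum_(j < k) b j * dirichlet_mass (incr b j))%R.
Proof.
move=> b0; apply: EFin_inj; rewrite EFinM -dirichlet_massE -dirichlet_expect_indic//.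
have mI : measurable_fun setT (EFin \o (\1_C : k.-tuple R -> R)) by exact/measurable_EFinP.
rewrite dirichlet_expect_incr//.
- rewrite -sumEFin; apply: eq_bigr => j _.
  by rewrite EFinM -dirichlet_massE -dirichlet_expect_indic.
- by move=> v; rewrite lee_fin.
- by rewrite dirichlet_expect_indic// dirichlet_massE ltry.
Qed.

(* Expected Dirichlet mass after M draws from v, each draw of colour j
   incrementing the parameter a_j; absolute values keep the integrand nonnegative
   off the simplex. *)
Fixpoint urn_mass (M : nat) (a : 'I_k -> R) (v : k.-tuple R) : R :=
  if M is M'.+1 then (\sum_(j < k) `|tnth v j| * urn_mass M' (incr a j) v)%R
  else dirichlet_mass a.

Lemma urn_mass_ge0 M a v : (0 <= urn_mass M a v)%R.
Proof.
elim: M a => [|M IH] a /=; first by case/andP: (dirichlet_mass_bounds a).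
by apply: sumr_ge0 => j _; rewrite mulr_ge0.
Qed.

Lemma measurable_urn_mass M a : measurable_fun setT (urn_mass M a).
Proof.
elim: M a => [|M IH] a //=; apply: measurable_sum => j; apply: measurable_funM => //.
by apply: measurableT_comp => //; exact: measurable_tnth.
Qed.

Lemma urn_mass_le1 M a v : (forall j, 0 <= tnth v j)%R -> (\sum_(j < k) tnth v j <= 1)%R ->
  (urn_mass M a v <= 1)%R.
Proof.
move=> v0 v1; elim: M a => [|M IH] a /=; first by case/andP: (dirichlet_mass_bounds a).
rewrite (le_trans _ v1)//; apply: ler_sum => j _.
by rewrite ger0_norm// ler_piMr.
Qed.

End dirichlet_urn.

(** * Reindexing binomial sums *)

Section binomial_reindex.
Context {R : realType}.
Variables (K N : nat) (n : {ffun 'I_K -> nat}).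
Hypothesis nN : forall l, (n l < N)%N.

Definition index_vec := {ffun 'I_K -> 'I_N.+1}.

Definition bin_prod (i : index_vec) : R := \prod_(l < K) 'C(n l, i l)%:R.

(** The absorption identity C(n, i) (n - i) = C(n, i + 1) (i + 1) in coordinate l, followed by the
    shift i_l + 1 -> i_l. *)
Lemma bin_prod_reindex l (phi : ('I_K -> nat) -> R) :
  \sum_(i : index_vec) bin_prod i * ((n l)%:R - (i l)%:R) * phi (fun l' => (i l' + (l' == l))%N) =
  \sum_(i : index_vec) bin_prod i * (i l)%:R * phi (fun l' => i l').
Proof.
pose up (i : index_vec) : index_vec := [ffun l' => if l' == l then inord (i l).+1 else i l'].
pose down (i : index_vec) : index_vec := [ffun l' => if l' == l then inord (i l).-1 else i l'].
rewrite [RHS](bigID (fun i : index_vec => (0 < i l)%N)) /= [X in _ = _ + X]big1 ?addr0; last first.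
  by move=> i; rewrite -eqn0Ngt => /eqP ->; rewrite mulr0 mul0r.
rewrite [RHS](reindex_onto up down) /=; last first.
  move=> i il; apply/ffunP => l'; rewrite !ffunE eqxx; case: eqVneq => [->|//].
  apply: val_inj; rewrite /= !inordK ?prednK// ltnW//.
(* Vectors with i_l = N cannot be raised inside the box, but their binomial factor vanishes because
   n_l < N. *)
rewrite (bigID (fun i : index_vec => (i l < N)%N)) /= [X in _ + X = _]big1 ?addr0; last first.
  move=> i; rewrite -leqNgt => Ni; rewrite /bin_prod (bigD1 l)//= bin_small ?mul0r//.
  exact: leq_trans (nN l) Ni.
apply: eq_big => [i|i iN].
  have [iN|Ni] := ltnP (i l) N.
    rewrite ffunE eqxx inordK// ; apply/esym/eqP/ffunP => l'; rewrite !ffunE eqxx.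
    case: eqVneq => [->|//]; apply: val_inj; rewrite /= !inordK//=.
  rewrite ffunE eqxx /inord /insubd insubF//.
  have -> : nat_of_ord (i l) = N by apply/eqP; rewrite eqn_leq Ni -ltnS ltn_ord.
  by rewrite ltnn.
have upl : nat_of_ord (up i l) = (i l).+1 by rewrite ffunE eqxx inordK.
congr (_ * phi _); last first.
  apply/funext => l'; case: (eqVneq l' l) => [->|l'l]; first by rewrite upl addn1.
  by rewrite addn0 ffunE (negbTE l'l).
rewrite /bin_prod (bigD1 l)//= [in RHS](bigD1 l)//= upl mulrAC [RHS]mulrAC; congr (_ * _).
  have [iln|nil] := leqP (i l) (n l).
    by rewrite -natrB// -!natrM [in RHS]mulnC mul_bin_left mulnC.
  by rewrite !bin_small ?mul0r// ltnW.
by apply: eq_bigr => l' l'l; rewrite ffunE (negbTE l'l).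
Qed.

End binomial_reindex.

(** * Self-duality of the pure-death chain *)

Section rising.
Context {R : realType}.
Implicit Type theta : R.

Definition rising theta k : R := \prod_(i < k) (theta + i%:R).

Lemma rising0 theta : rising theta 0 = 1.
Proof. by rewrite /rising big_ord0. Qed.

Lemma risingS theta k : rising theta k.+1 = rising theta k * (theta + k%:R).
Proof. by rewrite /rising big_ord_recr. Qed.

Lemma risingS_shift theta k : rising theta k.+1 = theta * rising (theta + 1) k.
Proof.
rewrite /rising big_ord_recl /= addr0; congr (_ * _).
by apply: eq_bigr => i _; rewrite /= /bump /= natrD addrA.
Qed.

Lemma rising_gt0 theta k : 0 < theta -> 0 < rising theta k.
Proof. by move=> th; apply: prodr_gt0 => i _; rewrite ltr_pwDl. Qed.

Lemma rising_neq0 theta k : 0 < theta -> rising theta k != 0.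
Proof. by move=> th; rewrite gt_eqF// rising_gt0. Qed.

(* The symmetric form of M_[r] (theta + r)^(s - r) / (theta + M)^(s), where _[r]
   and ^(s) denote falling and rising factorials. *)
Definition ancestral_weight theta (M s r : nat) : R :=
  (M ^_ r)%:R * (rising theta s * rising theta M) /
  (rising theta r * rising theta (M + s)).

Lemma ancestral_weight_ge0 theta M s r : 0 < theta ->
  0 <= ancestral_weight theta M s r.
Proof.
move=> th; rewrite /ancestral_weight divr_ge0 ?mulr_ge0//;
  by rewrite ltW// rising_gt0.
Qed.

Lemma ancestral_weight0 theta s r : 0 < theta ->
  ancestral_weight theta 0 s r = (r == 0%N)%:R.
Proof.
move=> th; rewrite /ancestral_weight; case: r => [|r].
  by rewrite ffactn0 rising0 add0n !mul1r mulr1 divff// rising_neq0.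
by rewrite ffact0n !mul0r.
Qed.

(** The recursion matches the first draw of the urn, which raises theta by one: either the draw
    comes from the base measure and the r retained atoms, and averages out, or it comes from a
    further atom and raises the retained count from r - 1 to r. *)
Lemma ancestral_weightS theta M s r : 0 < theta ->
  (theta + s%:R) * ancestral_weight theta M.+1 s r =
  (theta + r%:R) * ancestral_weight (theta + 1) M s r +
  r%:R * ancestral_weight (theta + 1) M s r.-1.
Proof.
move=> th; have th0 : theta != 0 by rewrite gt_eqF.
have shift k : rising (theta + 1) k = rising theta k * (theta + k%:R) / theta.
  by rewrite -risingS risingS_shift mulrC mulKf.
have thk k : theta + k%:R != 0 by rewrite gt_eqF// ltr_pwDl.
rewrite /ancestral_weight !shift addSn !risingS.
case: r => [|r] /=.
  rewrite !ffactn0 mul0r addr0.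
  rewrite rising0; have h2 := rising_neq0 (M + s) th; have := thk (M + s)%N.
  by rewrite natrD addr0 => h3; field; rewrite h2 h3 th0.
rewrite ffactSS ffactnSr natrM (natrM _ (M ^_ r)) !risingS.
have h1 := rising_neq0 r th; have h2 := rising_neq0 (M + s) th.
have h3 := thk (M + s)%N; have h4 := thk r; have h5 := thk r.+1.
have [rM|Mr] := leqP r M; last first.
  rewrite (ffact_small Mr) /= !(mul0r, mulr0, addr0)//.
rewrite natrB//; rewrite -!natr1 in h5 *; field.
by rewrite natrD in h3; rewrite h1 h2 h3 h4 th0 h5.
Qed.

(* The self-duality function of the pure-death chain. *)
Definition ancestral_prob theta (M s r : nat) : R :=
  'C(s, r)%:R * ancestral_weight theta M s r.

(** The only factor not visibly symmetric is C(s, r) M_[r], which equals r! C(s, r) C(M, r). *)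
Lemma ancestral_prob_sym theta M s r :
  ancestral_prob theta M s r = ancestral_prob theta s M r.
Proof.
rewrite /ancestral_prob /ancestral_weight addnC [rising theta s * _]mulrC.
rewrite !mulrA; congr (_ * _ * _ / _); rewrite -!natrM; congr _%:R.
by rewrite -!bin_ffact mulnCA.
Qed.

Lemma ancestral_prob_small theta M s r : (s < r)%N -> ancestral_prob theta M s r = 0.
Proof. by move=> sr; rewrite /ancestral_prob bin_small// mul0r. Qed.

Lemma ancestral_prob_ge0 theta M s r : 0 < theta ->
  0 <= ancestral_prob theta M s r.
Proof. by move=> th; rewrite mulr_ge0// ancestral_weight_ge0. Qed.

(** In the recursion for the weights the second sum is shifted by r C(s, r) = (s - r + 1) C(s, r -
    1); the coefficients theta + r and s - r then add up to theta + s. The total mass 1 gives the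
    bounds 0 and 1 on each term. *)
Lemma ancestral_prob_sum theta M s : 0 < theta ->
  \sum_(r < s.+1) ancestral_prob theta M s r = 1.
Proof.
elim: M theta => [|M IH] theta th.
  rewrite big_ord_recl /ancestral_prob ancestral_weight0// bin0 mul1r big1 ?addr0//.
  by move=> i _; rewrite ancestral_weight0// mulr0.
have ths : theta + s%:R != 0 by rewrite gt_eqF// ltr_pwDl.
apply: (mulfI ths); rewrite mulr1 mulr_sumr.
transitivity (\sum_(r < s.+1) (theta + r%:R) * ancestral_prob (theta + 1) M s r +
    \sum_(r < s.+1) (s%:R - r%:R) * ancestral_prob (theta + 1) M s r).
  rewrite [X in _ = _ + X]big_ord_recr /= subrr mul0r addr0.
  transitivity (\sum_(r < s.+1) (theta + r%:R) * ancestral_prob (theta + 1) M s r +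
      \sum_(r < s.+1) (r * 'C(s, r))%:R * ancestral_weight (theta + 1) M s r.-1).
    rewrite -big_split /=; apply: eq_bigr => r _.
    by rewrite /ancestral_prob mulrCA ancestral_weightS// natrM; ring.
  rewrite [X in _ + X = _]big_ord_recl /= mul0n mul0r add0r; congr (_ + _).
  apply: eq_bigr => r _; rewrite /= /bump add0n add1n mul_bin_left natrM natrB 1?ltnW//.
  by rewrite /ancestral_prob -mulrA.
rewrite -big_split /= (eq_bigr (fun r : 'I_s.+1 => (theta + s%:R) *
    ancestral_prob (theta + 1) M s r)) -?mulr_sumr ?IH ?mulr1 ?addr_gt0// => r _.
by ring.
Qed.

Lemma ancestral_prob_le1 theta M s r : 0 < theta -> ancestral_prob theta M s r <= 1.
Proof.
move=> th; have [rs|sr] := leqP r s; last by rewrite ancestral_prob_small.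
rewrite -(ancestral_prob_sum M s th) (bigD1 (Ordinal (rs : (r < s.+1)%N)))//= lerDl.
by apply: sumr_ge0 => i _; exact: ancestral_prob_ge0.
Qed.

(** The generator applied in u agrees with the generator applied in N. For positive u and N all four
    values are rational multiples of one common term, which leaves a field identity. If u or N is 0,
    its rate vanishes, and h is constant in the other variable. *)
Lemma ancestral_prob_duality theta N u r : 0 < theta ->
  death_rate theta u * (ancestral_prob theta N u.-1 r - ancestral_prob theta N u r) =
  death_rate theta N * (ancestral_prob theta N.-1 u r - ancestral_prob theta N u r).
Proof.
move=> th; case: u => [|u].
  rewrite /= subrr mulr0; case: N => [|N]; first by rewrite /death_rate !mul0r.
  rewrite /= (_ : _ - _ = 0) ?mulr0//.
  rewrite /ancestral_prob; case: r => [|r]; last by rewrite bin0n !mul0r subrr.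
  rewrite /ancestral_weight !ffactn0 rising0 !addn0 !mul1r !divff ?subrr//;
    by rewrite rising_neq0.
case: N => [|N].
  rewrite /= subrr mulr0 (_ : _ - _ = 0) ?mulr0//.
  rewrite /ancestral_prob !ancestral_weight0//; case: r => [|r].
    by rewrite !bin0 subrr.
  by rewrite !mulr0 subrr.
rewrite [u.+1.-1]/= [N.+1.-1]/= /ancestral_prob /ancestral_weight.
(* [C1] and [C2] express the lower binomial and falling factorial through the upper ones, with real
   subtraction, so that no case on r remains. *)
have C1 : 'C(u, r)%:R * u.+1%:R = 'C(u.+1, r)%:R * (u.+1%:R - r%:R) :> R.
  have [ru|ur] := leqP r u.+1; last by rewrite !bin_small ?mul0r// ltnW.
  by rewrite -natrB// -!natrM mulnC mul_bin_down mulnC.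
have C2 : (N ^_ r)%:R * N.+1%:R = (N.+1 ^_ r)%:R * (N.+1%:R - r%:R) :> R.
  have [ru|ur] := leqP r N.+1; last by rewrite !ffact_small ?mul0r// ltnW.
  by rewrite -natrB// -!natrM; congr _%:R; rewrite mulnC -ffactSS ffactnSr.
have h1 := rising_neq0 r th; have h2 := rising_neq0 (N + u) th.
have thk k : theta + k%:R != 0 by rewrite gt_eqF// ltr_pwDl.
have h3 := thk (N + u)%N; have h4 := thk (N + u).+1.
rewrite -!natr1 in C1 C2.
rewrite /death_rate !addSn !addnS !risingS -[u.+1%:R]natr1 -[N.+1%:R]natr1
  -[(N + u).+1%:R]natr1.
rewrite -natr1 in h4.
set A := (rising theta u) in h2 *; set B := rising theta N.
set c := 'C(u.+1, r)%:R in C1 *; set f := (N.+1 ^_ r)%:R in C2 *.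
set c' := 'C(u, r)%:R in C1 *; set f' := (N ^_ r)%:R in C2 *.
have u1 : u%:R + 1 != 0 :> R by rewrite natr1 pnatr_eq0.
have N1 : N%:R + 1 != 0 :> R by rewrite natr1 pnatr_eq0.
have -> : c' = c * (u%:R + 1 - r%:R) / (u%:R + 1) by rewrite -C1 mulfK.
have -> : f' = f * (N%:R + 1 - r%:R) / (N%:R + 1) by rewrite -C2 mulfK.
rewrite !natrD in h3 h4 *.
field.
rewrite u1 N1 h1 h2 h3 /=.
by rewrite h4.
Qed.

Lemma near_eq_cvgn (u v : nat -> R) (l : R) :
  (\forall n \near \oo, u n = v n) -> u @ \oo --> l -> v @ \oo --> l.
Proof. by move=> uv; apply: cvg_trans; exact: near_eq_cvg. Qed.

Lemma cvg_invr_shift (c : R) : 0 < c -> (c + n%:R)^-1 @[n --> \oo] --> (0 : R).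
Proof.
move=> c0; apply/gtr0_cvgV0; first by apply: nearW => n; rewrite ltr_pwDl.
exact: cvg_comp cvgr_idn (cvg_addrl c).
Qed.

(** The part depending on N is N_[r] theta^(N) / theta^(N + u), of order N^(r - u): its limit is 1
    for u = r and 0 for u > r, while the binomial vanishes for u < r. *)
Lemma cvg_ancestral_prob theta u r : 0 < theta ->
  ancestral_prob theta N u r @[N --> \oo] --> ((u == r)%:R : R).
Proof.
move=> th; have [ru|ur] := leqP r u; last first.
  rewrite ltn_eqF//; under eq_fun do rewrite ancestral_prob_small//.
  exact: cvg_cst.
have thk k : theta + k%:R != 0 by rewrite gt_eqF// ltr_pwDl.
have diag k : (N ^_ k)%:R * rising theta N / rising theta (N + k) @[N --> \oo] --> (1 : R).
  elim: k => [|k IH].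
    under eq_fun do rewrite ffactn0 addn0 mul1r divff ?rising_neq0//.
    exact: cvg_cst.
  (* Passing from k to k + 1 multiplies by (N - k) / (theta + k + N) = 1 - (theta + 2 k) / (theta +
     k + N). *)
  rewrite -[X in _ --> X](_ : 1 * (1 - (theta + 2 * k%:R) * 0) = 1); last first.
    by rewrite mulr0 subr0 mulr1.
  have thk0 : 0 < theta + k%:R by rewrite ltr_pwDl.
  apply: near_eq_cvgn (cvgM IH (cvgB (cvg_cst (1 : R))
    (cvgM (cvg_cst (theta + 2 * k%:R)) (cvg_invr_shift thk0)))).
  near=> N.
  have kN : (k <= N)%N by near: N; exact: nbhs_infty_ge.
  rewrite -[LHS]/((N ^_ k)%:R * rising theta N / rising theta (N + k) *
    (1 - (theta + 2 * k%:R) * (theta + k%:R + N%:R)^-1)).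
  rewrite ffactnSr natrM natrB// addnS risingS !natrD.
  have := rising_neq0 (N + k) th; have := thk (N + k)%N; rewrite natrD => h1 h2.
  have h3 : theta + k%:R + N%:R != 0 by rewrite -addrA [k%:R + _]addrC.
  by field; rewrite h1 h2.
have off i : (N ^_ r)%:R * rising theta N / rising theta (N + (r + i)) @[N --> \oo]
    --> ((i == 0%N)%:R : R).
  elim: i => [|i IH]; first by under eq_fun do rewrite addn0; exact: diag.
  rewrite -[X in _ --> X](mulr0 ((i == 0%N)%:R : R)).
  have thk0 : 0 < theta + (r + i)%:R by rewrite ltr_pwDl.
  apply: near_eq_cvgn (cvgM IH (cvg_invr_shift thk0)); apply: nearW => N.
  by rewrite /= !addnS risingS invfM mulrA -addrA -natrD [(r + i + N)%N]addnC.
rewrite -(subnKC ru); set i := (u - r)%N.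
have -> : (r + i == r)%N = (i == 0%N) by rewrite -[X in _ == X]addn0 eqn_add2l.
have -> : ((i == 0%N)%:R : R) =
    'C(r + i, r)%:R * (rising theta (r + i) / rising theta r) * (i == 0%N)%:R.
  case: i => [|i]; last by rewrite mulr0.
  by rewrite addn0 binn divff ?rising_neq0// !mul1r.
apply: near_eq_cvgn (cvgM (cvg_cst _) (off i)); apply: nearW => N.
by rewrite /= /ancestral_prob /ancestral_weight invfM; ring.
Unshelve. all: by end_near.
Qed.
End rising.

(** * Divided differences and the coefficients of the chain *)

Section divided_differences.
Context {R : realType}.
Implicit Types (x : nat -> R) (n k : nat).

(** For k <= n, the derivative at x_k of the nodal polynomial of x_0, ..., x_n: the denominator in
    the explicit formula for divided differences. *)
Definition node_prod x n k : R := \prod_(0 <= h < n.+1 | h != k) (x k - x h).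

Lemma node_prod_recr x n k : (k <= n)%N ->
  node_prod x n.+1 k = node_prod x n k * (x k - x n.+1).
Proof.
move=> kn; rewrite /node_prod big_mkcond big_nat_recr//= -big_mkcond.
by rewrite gtn_eqF.
Qed.

Lemma node_prod_recl x n k :
  node_prod x n.+1 k.+1 = (x k.+1 - x 0%N) * node_prod (x \o S) n k.
Proof. by rewrite /node_prod big_mkcond big_nat_recl//= -big_mkcond. Qed.

Lemma node_prod_neq0 x n k : (forall i j, (i <= n)%N -> (j <= n)%N -> x i = x j -> i = j) ->
  (k <= n)%N -> node_prod x n k != 0.
Proof.
move=> xI kn; rewrite /node_prod big_nat_cond prodf_seq_neq0; apply/allP => h _.
apply/implyP => /andP[/andP[_ hn] hk]; rewrite subr_eq0.
by apply: contra_neq hk => /xI -> //.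
Qed.

(* The divided difference of the constant function 1. *)
Lemma sum_inv_node_prod x n : (forall i j, (i <= n)%N -> (j <= n)%N -> x i = x j -> i = j) ->
  \sum_(0 <= k < n.+1) (node_prod x n k)^-1 = (n == 0%N)%:R.
Proof.
elim: n x => [|n IH] x xI.
  by rewrite big_nat1 /node_prod big_mkcond big_nat1 eqxx invr1.
have xn k : (k <= n)%N -> x k - x n.+1 != 0.
  move=> kn; rewrite subr_eq0; apply/eqP => /xI kE.
  by have kE2 := kE (leqW kn) (leqnn _); rewrite kE2 ltnn in kn.
have x0 k : (k <= n)%N -> x k.+1 - x 0%N != 0.
  by move=> kn; rewrite subr_eq0; apply/eqP => /xI kE; have := kE kn isT.
have x0n := xn 0%N isT.
apply: (mulfI x0n); rewrite mulr0.
(* x_0 - x_(n+1) is split as (x_k - x_(n+1)) - (x_k - x_0); each factor deletes one end node, as in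
   the recursion for divided differences. *)
transitivity (\sum_(0 <= k < n.+2) (x k - x n.+1) / node_prod x n.+1 k -
              \sum_(0 <= k < n.+2) (x k - x 0%N) / node_prod x n.+1 k).
  rewrite mulr_sumr -sumrB; apply: eq_bigr => k _; ring.
rewrite big_nat_recr//= subrr mul0r addr0 [X in _ - X]big_nat_recl//= subrr mul0r add0r.
transitivity (\sum_(0 <= k < n.+1) (node_prod x n k)^-1 -
              \sum_(0 <= k < n.+1) (node_prod (x \o S) n k)^-1).
  congr (_ - _); rewrite !big_nat; apply: eq_bigr => k /andP[_ kn].
    by rewrite node_prod_recr// invfM mulrCA divff ?mulr1// xn.
  by rewrite node_prod_recl invfM mulrA divff ?mul1r// x0.
rewrite !IH ?subrr// => i j in_ jn; first by move=> /xI -/(_ in_ jn)[].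
by apply: xI; rewrite leqW.
Qed.

End divided_differences.

Section pure_death_coefficients.
Context {R : realType}.
Variable theta : R.
Hypothesis theta_gt0 : 0 < theta.
Local Notation lambda := (death_rate theta).

Lemma death_rate_ge0 n : 0 <= lambda n.
Proof.
rewrite /death_rate; case: n => [|n]; first by rewrite !mul0r.
by rewrite -natr1 addrA addrK !mulr_ge0// addr_ge0// ltW.
Qed.

Lemma death_rate0 : lambda 0 = 0.
Proof. by rewrite /death_rate !mul0r. Qed.

Lemma death_rateB i j :
  lambda i - lambda j = (i%:R - j%:R) * (theta + (i + j)%:R - 1) / 2.
Proof. by rewrite /death_rate natrD; field. Qed.

Lemma death_rate_inj : injective lambda.
Proof.
move=> i j /eqP; rewrite -subr_eq0 death_rateB !mulf_eq0 invr_eq0 pnatr_eq0 orbF.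
have [->//|ij] := eqVneq i j; rewrite subr_eq0 eqr_nat (negbTE ij) /=.
(* Distinct i and j have i + j >= 1, so this factor is at least theta. *)
suff /lt0r_neq0/negbTE -> : 0 < theta + (i + j)%:R - 1 by [].
case: i j ij => [|i] [|j]// _; rewrite ?addSn ?addnS -natr1 addrA addrK ltr_pwDl//.
Qed.

Lemma death_rate_subn_inj s r : (r <= s)%N ->
  forall i j, (i <= r)%N -> (j <= r)%N -> lambda (s - i) = lambda (s - j) -> i = j.
Proof.
move=> rs i j ir jr /death_rate_inj.
by move/(congr1 (subn s)); rewrite !subKn// (leq_trans _ rs).
Qed.

Lemma death_coefE s j t : death_coef theta s j t =
  (\prod_(0 <= h < j) lambda (s - h)%N) * (-1) ^+ j *
  \sum_(0 <= k < j.+1) expR (- lambda (s - k)%N * t) /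
    node_prod (fun h => lambda (s - h)%N) j k.
Proof. by []. Qed.

(** The term-by-term derivative in t, given as a formula; [death_coef_step] is what relates it to
    [death_coef]. *)
Definition death_coef_deriv s j t : R :=
  (\prod_(0 <= h < j) lambda (s - h)%N) * (-1) ^+ j *
  \sum_(0 <= k < j.+1) - lambda (s - k)%N * expR (- lambda (s - k)%N * t) /
    node_prod (fun h => lambda (s - h)%N) j k.

Lemma death_coef_init s j : (j <= s)%N -> death_coef theta s j 0 = (j == 0%N)%:R.
Proof.
move=> js; rewrite death_coefE.
under [X in _ * X = _]eq_bigr do rewrite mulr0 expR0 div1r.
rewrite sum_inv_node_prod; last exact: death_rate_subn_inj.
case: j js => [|j] js; last by rewrite mulr0.
by rewrite big_geq// expr0 !mulr1.
Qed.

Lemma death_coef0 s t : death_coef theta s 0 t = expR (- lambda s * t).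
Proof.
by rewrite death_coefE big_geq// expr0 !mul1r big_nat1 /node_prod big_mkcond big_nat1
  eqxx invr1 mulr1 subn0.
Qed.

Lemma death_coef_deriv0 s t :
  death_coef_deriv s 0 t = - lambda s * death_coef theta s 0 t.
Proof.
by rewrite death_coef0 /death_coef_deriv big_geq// expr0 !mul1r big_nat1 /node_prod
  big_mkcond big_nat1 eqxx invr1 mulr1 subn0.
Qed.

(** Kolmogorov's forward equation. Adding lambda_(s-j-1) times the coefficient to its derivative
    multiplies the k-th term by a difference of nodes, which cancels the last factor of [node_prod]
    and kills the term k = j + 1. *)
Lemma death_coef_derivS s j t : (j < s)%N ->
  death_coef_deriv s j.+1 t =
  lambda (s - j) * death_coef theta s j t - lambda (s - j.+1) * death_coef theta s j.+1 t.
Proof.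
move=> js; apply/eqP; rewrite eq_sym subr_eq eq_sym; apply/eqP.
rewrite !death_coefE /death_coef_deriv big_nat_recr//= exprS.
set P := \prod_(0 <= h < j) _; set e := (-1) ^+ j.
transitivity (- (P * lambda (s - j) * e) * \sum_(0 <= k < j.+2)
   (lambda (s - j.+1) - lambda (s - k)) * expR (- lambda (s - k)%N * t) /
    node_prod (fun h => lambda (s - h)%N) j.+1 k).
  rewrite [in RHS](eq_bigr (fun k => - lambda (s - k)%N * expR (- lambda (s - k)%N * t) /
    node_prod (fun h => lambda (s - h)%N) j.+1 k +
    lambda (s - j.+1) * (expR (- lambda (s - k)%N * t) /
    node_prod (fun h => lambda (s - h)%N) j.+1 k))); last by move=> k _; ring.
  by rewrite big_split /= -mulr_sumr; ring.
rewrite big_nat_recr//= subrr !mul0r addr0.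
rewrite (eq_big_nat _ _ (F2 := fun k => - (expR (- lambda (s - k)%N * t) /
    node_prod (fun h => lambda (s - h)%N) j k))); last first.
  move=> k /andP[_ kj]; rewrite node_prod_recr//; set E := expR _.
  have inj := death_rate_subn_inj js.
  have n0 : node_prod (fun h => lambda (s - h)%N) j k != 0.
    by apply: node_prod_neq0 => // ? ? ij kj'; apply: inj; rewrite leqW.
  have a0 : lambda (s - k)%N - lambda (s - j.+1)%N != 0.
    rewrite subr_eq0; apply/eqP => /(inj _ _ (ltnW kj) (leqnn _)) kE.
    by rewrite kE ltnn in kj.
  by field; rewrite a0 n0.
by rewrite sumrN; ring.
Qed.

Definition expR_remainder (a h : R) : R := expR (- a * h) - 1 + a * h.

(** With x = a h, the bounds 1 - x <= e^(-x) <= 1 / (1 + x) place the remainder between 0 and x^2 /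
    (1 + x). *)
Lemma expR_remainder_bound a h : 0 <= a -> 0 <= h ->
  `|expR_remainder a h| <= a ^+ 2 * h ^+ 2.
Proof.
move=> a0 h0; rewrite /expR_remainder mulNr -exprMn; set x := a * h.
have x0 : 0 <= x by rewrite mulr_ge0.
have := expR_ge1Dx (- x); rewrite -(subr_ge0 (1 - x)) => e1.
rewrite ger0_norm; last by rewrite (le_trans e1)//; lra.
have : expR (- x) <= (1 + x)^-1.
  by rewrite expRN lef_pV2 ?posrE ?expR_gt0 ?expR_ge1Dx// ltr_pwDl.
move=> /le_trans e2; rewrite -addrA -lerBrDr; apply: e2.
have x1 : 0 < 1 + x by rewrite ltr_pwDl.
by rewrite -[leLHS]mul1r ler_pdivrMr//; nra.
Qed.

(** The constant does not depend on t because e^(-lambda t) <= 1 for t >= 0; [approx_flow] asks for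
    this uniformity. *)
Lemma death_coef_step s j : exists2 C : R, 0 <= C & forall t h, 0 <= t -> 0 <= h ->
  `|death_coef theta s j (t + h) - death_coef theta s j t - h * death_coef_deriv s j t|
    <= C * h ^+ 2.
Proof.
pose w k := (node_prod (fun h => lambda (s - h)%N) j k)^-1.
set Q := (\prod_(0 <= h < j) lambda (s - h)%N) * (-1) ^+ j.
exists (`|Q| * \sum_(0 <= k < j.+1) `|w k| * lambda (s - k) ^+ 2) => [|t h t0 h0].
  by rewrite mulr_ge0// sumr_ge0// => k _; rewrite mulr_ge0// sqr_ge0.
rewrite !death_coefE /death_coef_deriv -/Q mulrCA -!mulrBr normrM -mulrA ler_wpM2l//.
rewrite mulr_sumr -!sumrB mulr_suml; apply: le_trans (ler_norm_sum _ _ _) _.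
apply: ler_sum => k _; rewrite -/(w k).
rewrite (_ : _ - _ - _ = w k * (expR (- lambda (s - k) * t) *
    expR_remainder (lambda (s - k)) h)); last first.
  by rewrite /expR_remainder mulrDr expRD -!/(w k); ring.
rewrite normrM -mulrA ler_wpM2l// normrM (le_trans _ (expR_remainder_bound _ h0))//.
  rewrite ler_piMl// ger0_norm ?expR_ge0// -expR0 ler_expR mulNr oppr_le0.
  by rewrite mulr_ge0// death_rate_ge0.
exact: death_rate_ge0.
Qed.

End pure_death_coefficients.

(** * Averages over laws on the nonnegative integers *)

Section sequence_expectation.
Context {R : realType}.
Implicit Types (p f g : nat -> R).

Definition seq_law p := (forall k, 0 <= p k) /\ (\sum_(0 <= k <oo) (p k)%:E = 1)%E.

Definition seq_expect p f : R := fine (\sum_(0 <= k <oo) (p k * f k)%:E)%E.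

Definition bounded01 f := forall k, 0 <= f k <= 1.

Lemma nneseries_split_seq (u : nat -> \bar R) (s : seq nat) :
  (forall k, (0 <= u k)%E) -> uniq s ->
  (\sum_(0 <= k <oo) u k = \sum_(k <- s) u k + \sum_(0 <= k <oo | k \notin s) u k)%E.
Proof.
move=> u0; elim: s => [_|x s IH /= /andP[xs us]]; first by rewrite big_nil add0e.
rewrite IH// (@nneseriesD1 _ u x (fun k => k \notin s))// big_cons.
rewrite addeCA addeA; congr (_ + _)%E.
by apply: eq_eseriesl => k; rewrite inE negb_or andbC.
Qed.

(** Stands in for dominated convergence: outside a finite list the sum is between c and 1 times the
    missing mass. The constant c is positive only in the tightness estimate. *)
Lemma seq_expect_split p f (s : seq nat) c : seq_law p -> bounded01 f -> uniq s ->
  0 <= c -> (forall k, k \notin s -> c <= f k) ->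
  exists2 r : R, seq_expect p f = \sum_(k <- s) p k * f k + r &
                 c * (1 - \sum_(k <- s) p k) <= r <= 1 - \sum_(k <- s) p k.
Proof.
move=> [p0 p1] f01 us c0 cf.
have f0 k : 0 <= f k by case/andP: (f01 k).
have f1 k : f k <= 1 by case/andP: (f01 k).
have := @nneseries_split_seq (fun k => (p k)%:E) s (fun k => p0 k) us.
rewrite p1 sumEFin => H1.
have pf0 k : (0 <= (p k * f k)%:E)%E by rewrite lee_fin mulr_ge0.
rewrite /seq_expect (nneseries_split_seq pf0 us) sumEFin.
set T1 := (\sum_(0 <= k <oo | k \notin s) (p k)%:E)%E in H1.
set T := (\sum_(0 <= k <oo | _) _)%E.
have T0 : (0 <= T)%E by apply: nneseries_ge0 => k _ _.
have TT1 : (T <= T1)%E.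
  by apply: lee_nneseries => [i _ _//|k _]; rewrite lee_fin ler_piMr.
have cT1 : (c%:E * T1 <= T)%E.
  rewrite -nneseriesZl; last by move=> k _; rewrite lee_fin.
  apply: lee_nneseries => [k _ _|k ks]; rewrite -EFinM lee_fin ?mulr_ge0//.
  by rewrite mulrC ler_wpM2l ?cf.
have T1fin : T1 \is a fin_num.
  move: H1; case: T1 {TT1 cT1} => [r| |]//=.
have Tfin : T \is a fin_num.
  by rewrite ge0_fin_numE// (le_lt_trans TT1)// ltey_eq T1fin.
exists (fine T); first by rewrite -[in LHS](fineK Tfin).
move: H1 cT1; rewrite -(fineK T1fin) => -[] ->; rewrite [_ + fine _]addrC addrK.
by rewrite -EFinM -[T in (_ <= T)%E](fineK Tfin) lee_fin => ->; rewrite fine_le.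
Qed.

Lemma seq_expectE p f : seq_law p -> bounded01 f ->
  ((seq_expect p f)%:E = \sum_(0 <= k <oo) (p k * f k)%:E)%E.
Proof.
move=> [p0 p1] f01; rewrite /seq_expect fineK//.
have f0 k : 0 <= f k by case/andP: (f01 k).
have f1 k : f k <= 1 by case/andP: (f01 k).
have le1 : (\sum_(0 <= k <oo) (p k * f k)%:E <= 1)%E.
  by rewrite -p1; apply: lee_nneseries => [i _ _|k _]; rewrite lee_fin ?mulr_ge0// ler_piMr.
rewrite ge0_fin_numE; first by rewrite (le_lt_trans le1)// ltry.
by apply: nneseries_ge0 => k _ _; rewrite lee_fin mulr_ge0.
Qed.

Lemma seq_expect01 p f : seq_law p -> bounded01 f -> 0 <= seq_expect p f <= 1.
Proof.
move=> pl f01; have f0 k : k \notin [::] -> 0 <= f k by case/andP: (f01 k).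
have [r] := @seq_expect_split p f [::] 0 pl f01 isT (lexx _) f0.
by rewrite !big_nil add0r subr0 mul0r => ->.
Qed.

End sequence_expectation.

(** * Uniqueness for the backward equations *)

Section flow.
Context {R : realType}.
Implicit Types (rate : nat -> R) (e f g : nat -> R -> R).

(* e solves e_n' = - rate_n (e_n - e_(n-1)) with a uniform error at each time. *)
Definition approx_flow rate e := forall n (eps : R), 0 < eps ->
  \forall h \near 0^'+, forall t, 0 <= t ->
    `|e n (t + h) - e n t + rate n * h * (e n t - e n.-1 t)| <= eps * h.

Lemma approx_flowB rate f g : approx_flow rate f -> approx_flow rate g ->
  approx_flow rate (fun n t => f n t - g n t).
Proof.
move=> Hf Hg n eps eps0; have eps2 : 0 < eps / 2 by rewrite divr_gt0.
have := Hf n _ eps2; have := Hg n _ eps2.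
apply: filterS2 => h hg hf t t0.
rewrite (_ : _ + _ = (f n (t + h) - f n t + rate n * h * (f n t - f n.-1 t)) -
  (g n (t + h) - g n t + rate n * h * (g n t - g n.-1 t))); last by ring.
apply: le_trans (ler_normB _ _) _.
by rewrite (splitr eps) mulrDl lerD ?hf ?hg.
Qed.

(** The system is triangular, so induction on n makes the term e_(n-1) drop out. On a grid of mesh h
    with rate_n h <= 1, each step then contracts |e_n| up to an error (eps / t) h, and the errors on
    [0, t] add up to at most eps. *)
Lemma approx_flow_eq0 rate e : rate 0%N = 0 -> (forall n, 0 <= rate n) ->
  approx_flow rate e -> (forall n, e n 0 = 0) -> forall n t, 0 <= t -> e n t = 0.
Proof.
move=> r0 rge0 He e0.
(* The product, not e_(n-1) itself, is assumed to vanish: at n = 0 the predecessor is 0 again, and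
   only the rate is known to be 0. *)
suff step n : (forall t, 0 <= t -> rate n * e n.-1 t = 0) -> forall t, 0 <= t -> e n t = 0.
  by elim=> [|n IH]; apply: step => t t0; rewrite ?r0 ?mul0r//= IH// mulr0.
move=> Hp t; rewrite le_eqVlt => /predU1P[<-//|t0].
apply/eqP; rewrite -normr_le0; apply/ler_addgt0Pl => eps eps0; rewrite addr0.
have eps'0 : 0 < eps / t by rewrite divr_gt0.
have c0 : 0 < (rate n + 1)^-1 by rewrite invr_gt0 ltr_wpDl.
have [d /= d0 Hd] : exists2 d : R, 0 < d & forall h, 0 < h -> h < d ->
    rate n * h <= 1 /\
    forall u, 0 <= u -> `|e n (u + h) - e n u + rate n * h * (e n u - e n.-1 u)| <= eps / t * h.
  have /nbhs_ballP[d /= d0 Hd] := He n _ eps'0.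
  exists (Num.min d (rate n + 1)^-1); first by rewrite lt_min d0.
  move=> h h0; rewrite lt_min => /andP[hd hr]; split; last first.
    by apply: Hd => //; rewrite /ball/= sub0r normrN gtr0_norm.
  rewrite (@le_trans _ _ ((rate n + 1) * h))// ?ler_wpM2r ?lerDl// ?ltW//.
  by rewrite -ltr_pdivlMl ?mulr1// ltr_wpDl.
(* j exceeds t / d, so the mesh h = t / j lies below d. *)
pose j := Num.bound (t / d); pose h := t / j%:R.
have tdj : t / d < j%:R by apply: archi_boundP; rewrite divr_ge0// ltW.
have j0 : 0 < j%:R :> R by rewrite (le_lt_trans _ tdj)// divr_ge0// ltW.
have h0 : 0 < h by rewrite divr_gt0.
have [rh Hh] : rate n * h <= 1 /\
    forall u, 0 <= u -> `|e n (u + h) - e n u + rate n * h * (e n u - e n.-1 u)| <= eps / t * h.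
  by apply: Hd => //; rewrite /h ltr_pdivrMr// mulrC -ltr_pdivrMr.
have iter i : `|e n (i%:R * h)| <= eps / t * (i%:R * h).
  elim: i => [|i IH]; first by rewrite !mul0r mulr0 e0 normr0.
  have ih0 : 0 <= i%:R * h by rewrite mulr_ge0// ltW.
  rewrite -natr1 mulrDl mul1r mulrDr.
  rewrite (_ : e n (i%:R * h + h) = (1 - rate n * h) * e n (i%:R * h) +
    (e n (i%:R * h + h) - e n (i%:R * h) +
     rate n * h * (e n (i%:R * h) - e n.-1 (i%:R * h)))); last first.
    by have := Hp _ ih0; rewrite mulrBr [rate n * h * e n.-1 _]mulrAC => ->; ring.
  apply: le_trans (ler_normD _ _) _; rewrite lerD ?Hh// normrM.
  apply: le_trans IH; rewrite ler_piMl// ger0_norm ?subr_ge0// gerBl.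
  by rewrite mulr_ge0// ltW.
have := iter j; rewrite /h mulrC divfK ?gt_eqF//.
by rewrite divfK ?gt_eqF// addr0.
Qed.

End flow.

(** * Duality averages and the chain started at infinity *)

Section pure_death_duality.
Context {R : realType}.
Variables (theta : R) (P : R -> nat -> nat -> R).
Hypothesis theta_gt0 : 0 < theta.
Local Notation lambda := (death_rate theta).
Hypothesis deathP : is_pure_death lambda P.

Lemma death_seq_law t n : 0 <= t -> seq_law (P t n).
Proof. by move=> t0; case: deathP => P0 P1 _ _ _; split=> [k|]; [exact: P0|exact: P1]. Qed.

Lemma death_expect0 f n : bounded01 f -> seq_expect (P 0 n) f = f n.
Proof.
move=> f01; have f0 k : k \notin [:: n] -> 0 <= f k by case/andP: (f01 k).
have [r] := seq_expect_split (death_seq_law n (lexx 0)) f01 (isT : uniq [:: n]) (lexx _) f0.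
case: deathP => _ _ P0 _ _; rewrite !big_seq1 !P0 eqxx mul1r mul0r subrr => -> /andP[r0 r1].
by rewrite (@le_anti _ _ r 0) ?addr0// r1.
Qed.

Lemma bounded01_death_expect f t : 0 <= t -> bounded01 f ->
  bounded01 (fun l => seq_expect (P t l) f).
Proof. by move=> t0 f01 l; apply: seq_expect01 => //; exact: death_seq_law. Qed.

Lemma death_expectD f s t n : 0 <= s -> 0 <= t -> bounded01 f ->
  seq_expect (P (s + t) n) f = seq_expect (P s n) (fun l => seq_expect (P t l) f).
Proof.
move=> s0 t0 f01; apply: EFin_inj.
rewrite seq_expectE//; last by apply: death_seq_law; exact: addr_ge0.
rewrite seq_expectE; [|exact: death_seq_law|exact: bounded01_death_expect].
have f0 k : 0 <= f k by case/andP: (f01 k).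
case: deathP => P0 _ _ Padd _.
transitivity (\sum_(0 <= k <oo) \sum_(0 <= l <oo) (P s n l * P t l k * f k)%:E)%E.
  apply: eq_eseriesr => k _; rewrite mulrC EFinM Padd// -nneseriesZl//.
    by apply: eq_eseriesr => l _; rewrite -EFinM mulrC.
  by move=> l _; rewrite lee_fin mulr_ge0 ?P0.
rewrite nneseries_interchange; last by move=> i j; rewrite lee_fin !mulr_ge0 ?P0.
apply: eq_eseriesr => l _; rewrite EFinM seq_expectE//; last exact: death_seq_law.
rewrite -nneseriesZl; first by apply: eq_eseriesr => k _; rewrite -EFinM mulrA.
by move=> k _; rewrite lee_fin mulr_ge0 ?P0.
Qed.

Lemma death_small n k : forall eps : R, 0 < eps -> \forall h \near 0^'+,
  `|P h n k - (n == k)%:R - h * death_generator lambda n k| <= eps * h.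
Proof.
move=> eps eps0; case: deathP => _ _ _ _ /(_ n k) /cvgrPdist_le /(_ _ eps0).
apply: filterS2 (nbhs_right_gt 0) => h h0; rewrite distrC => H.
rewrite -[X in _ <= X * _]/eps -ler_pdivrMr// -[X in _ / X](gtr0_norm h0) -normf_div.
by rewrite mulrBl mulrAC divff ?mul1r// gt_eqF.
Qed.

(** The backward equation, from the semigroup property with the short step first. Only the entries n
    and n - 1 of the row are expanded: since the row sums to 1, all other states carry mass o(h),
    and the bounds 0 <= f <= 1 make the error uniform in t. *)
Lemma death_expect_flow f : bounded01 f ->
  approx_flow lambda (fun n t => seq_expect (P t n) f).
Proof.
move=> f01 n eps eps0.
(* Each of the two expanded entries errs by at most eps h / 4, and the remaining mass is bounded by
   the sum of their errors, which makes four quarters. *)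
have eps4 : 0 < eps / 4 by rewrite divr_gt0.
have [H1 H2] := (@death_small n n _ eps4, @death_small n n.-1 _ eps4).
apply: filterS3 (nbhs_right_gt 0) H1 H2 => h h0 /= h1 h2 t t0.
rewrite [t + h]addrC death_expectD ?(ltW h0)//.
set A := fun l => seq_expect (P t l) f; rewrite -/(A n) -/(A n.-1).
have A01 : bounded01 A by exact: bounded01_death_expect.
have /andP[An0 An1] := A01 n; have /andP[Am0 Am1] := A01 n.-1.
(* The factor (n != 0) prevents state 0 from being counted twice, since 0 is its own predecessor. *)
have [r] : exists2 r, seq_expect (P h n) A = P h n n * A n +
     (n != 0%N)%:R * (P h n n.-1 * A n.-1) + r &
     0 <= r <= 1 - P h n n - (n != 0%N)%:R * P h n n.-1.
  case: n {h1 h2 An0 An1 Am0 Am1} => [|n].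
    have A0 k : k \notin [:: 0%N] -> 0 <= A k by case/andP: (A01 k).
    have [r] := seq_expect_split (death_seq_law 0 (ltW h0)) A01 (isT : uniq [:: 0%N]) (lexx _) A0.
    rewrite !big_seq1 mul0r => H rb; by exists r; rewrite ?mul0r ?addr0 ?subr0.
  have us : uniq [:: n.+1; n] by rewrite /= inE eqn_leq ltnn.
  have A0 k : k \notin [:: n.+1; n] -> 0 <= A k by case/andP: (A01 k).
  have [r] := seq_expect_split (death_seq_law n.+1 (ltW h0)) A01 us (lexx _) A0.
  rewrite !big_cons !big_nil !addr0 mul0r => H rb; by exists r; rewrite ?mul1r// -addrA -opprD.
move=> -> /andP[r0 r1].
move: h1 h2; rewrite !ler_norml /death_generator eqxx.
case: n An0 An1 Am0 Am1 r1 => [|n] An0 An1 Am0 Am1 r1 /andP[a1 a2] /andP[b1 b2].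
  by move: r1 a1 a2; rewrite death_rate0 eqxx /=; nra.
move: r1 a1 a2 b1 b2; rewrite /= eqxx (gtn_eqF (ltnSn n)).
set p := P h n.+1 n.+1; set q := P h n.+1 n; set l := lambda n.+1.
rewrite !mul1r /= subr0 mulrN opprK => r1 a1 a2 b1 b2.
set a := A n.+1 in An0 An1 *; set b := A n in Am0 Am1 *.
have -> : p * a + q * b + r - a + l * h * (a - b) = (p - 1 + h * l) * a + (q - h * l) * b + r.
  by ring.
set x := p - 1 + h * l in a1 a2 *; set y := q - h * l in b1 b2 *.
have r2 : r <= - x - y by rewrite (le_trans r1)// /x /y; lra.
have eh : 0 <= eps / 4 * h by rewrite mulr_ge0 ?ltW.
have -> : eps * h = 4 * (eps / 4 * h) by field.
set z := eps / 4 * h in a1 a2 b1 b2 eh *.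
have xa : - z <= x * a <= z by apply/andP; split; nra.
have yb : - z <= y * b <= z by apply/andP; split; nra.
by apply/andP; split; lra.
Qed.

(** The sum over u = s - j of h_n(u, r), with [death_coef theta s j t] in the role of the transition
    probability from s to u; u < r is left out because h_n(u, r) = 0 there. *)
Definition ancestral_transition s r n t : R :=
  \sum_(j < (s - r).+1) death_coef theta s j t * ancestral_prob theta n (s - j) r.

Lemma death_coef_small s j (eps : R) : 0 < eps ->
  \forall h \near 0^'+, forall t, 0 <= t ->
  `|death_coef theta s j (t + h) - death_coef theta s j t - h * death_coef_deriv theta s j t|
    <= eps * h.
Proof.
move=> eps0; have [C C0 HC] := death_coef_step theta_gt0 s j.
have d0 : 0 < eps / (C + 1) by rewrite divr_gt0// ltr_wpDl.
apply: filterS2 (nbhs_right_gt 0) (nbhs_right_lt d0) => h h0 hd t t0.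
apply: le_trans (HC _ _ t0 (ltW h0)) _; rewrite expr2 mulrA ler_wpM2r ?(ltW h0)//.
rewrite (@le_trans _ _ ((C + 1) * h))// ?ler_wpM2r ?lerDl ?(ltW h0)//.
by rewrite mulrC -ler_pdivlMr ?(ltW hd)// ltr_wpDl.
Qed.

(** Summation by parts with the forward equation moves the generator from the coefficients to the
    argument s - j of h; duality then moves it to n. *)
Lemma ancestral_transition_deriv s r n t : (r <= s)%N ->
  \sum_(j < (s - r).+1) death_coef_deriv theta s j t * ancestral_prob theta n (s - j) r =
  - lambda n * (ancestral_transition s r n t - ancestral_transition s r n.-1 t).
Proof.
move=> rs; pose c j := death_coef theta s j t.
pose H j := ancestral_prob theta n (s - j) r.
have parts J : (J <= s)%N ->
    \sum_(j < J.+1) death_coef_deriv theta s j t * H j =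
    \sum_(j < J.+1) c j * (lambda (s - j) * (H j.+1 - H j)) - c J * (lambda (s - J) * H J.+1).
  elim: J => [_|J IH Js].
    by rewrite !big_ord1 subn0 death_coef_deriv0 -/(c 0%N); ring.
  rewrite big_ord_recr /= IH ?(ltnW Js)// [in RHS]big_ord_recr /= death_coef_derivS//.
  by rewrite -/(c J) -/(c J.+1); ring.
have -> := parts _ (leq_subr r s).
(* The boundary term is lambda_r h_n(r - 1, r): the second factor is 0 if r > 0, and lambda_0 =
   0. *)
rewrite subKn// (_ : lambda r * _ = 0); last first.
  rewrite /H; case: r rs {parts H} => [|r] rs; first by rewrite death_rate0 mul0r.
  by rewrite subnS subKn// ancestral_prob_small ?mulr0.
rewrite mulr0 subr0 -sumrB mulr_sumr; apply: eq_bigr => j _.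
by rewrite /H subnS ancestral_prob_duality// -/(c j); ring.
Qed.

Lemma ancestral_transition_flow s r : (r <= s)%N ->
  approx_flow lambda (ancestral_transition s r).
Proof.
move=> rs n eps eps0; set J := (s - r).+1.
have epsJ : 0 < eps / J%:R by rewrite divr_gt0.
have HJ : \forall h \near 0^'+, forall j : 'I_J, forall t, 0 <= t ->
  `|death_coef theta s j (t + h) - death_coef theta s j t - h * death_coef_deriv theta s j t|
    <= eps / J%:R * h by apply: filter_forall => j; exact: death_coef_small.
apply: filterS2 (nbhs_right_gt 0) HJ => h h0 Hh t t0.
rewrite (_ : _ + _ = \sum_(j < J) (death_coef theta s j (t + h) - death_coef theta s j t -
    h * death_coef_deriv theta s j t) * ancestral_prob theta n (s - j) r); last first.
  rewrite [RHS](eq_bigr (fun j : 'I_J =>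
    death_coef theta s j (t + h) * ancestral_prob theta n (s - j) r -
    death_coef theta s j t * ancestral_prob theta n (s - j) r -
    h * (death_coef_deriv theta s j t * ancestral_prob theta n (s - j) r))); last first.
    by move=> j _; ring.
  rewrite !sumrB -mulr_sumr ancestral_transition_deriv//.
  by rewrite /ancestral_transition -/J; ring.
apply: le_trans (ler_norm_sum _ _ _) _.
rewrite [leRHS](_ : _ = \sum_(j < J) eps / J%:R * h); last first.
  by rewrite sumr_const card_ord -mulr_natl; field; rewrite pnatr_eq0.
apply: ler_sum => j _; rewrite normrM (le_trans _ (Hh j t t0))// ler_piMr//.
by rewrite ger0_norm ?ancestral_prob_le1// ancestral_prob_ge0.
Qed.

Lemma bounded01_ancestral_prob s r : bounded01 (fun M => ancestral_prob theta M s r).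
Proof. by move=> M; rewrite ancestral_prob_ge0// ancestral_prob_le1. Qed.

(** Both sides solve the same backward equation in n with the initial value h_n(s, r), so their
    difference is 0 by uniqueness. *)
Lemma death_expect_ancestral_prob s r n t : (r <= s)%N -> 0 <= t ->
  seq_expect (P t n) (fun M => ancestral_prob theta M s r) = ancestral_transition s r n t.
Proof.
move=> rs t0; apply/eqP; rewrite -subr_eq0; apply/eqP; move: n t t0.
apply: (@approx_flow_eq0 _ lambda (fun n t => seq_expect _ _ - ancestral_transition s r n t)).
- exact: death_rate0.
- exact: death_rate_ge0.
- apply: (approx_flowB (death_expect_flow _) (ancestral_transition_flow rs)).
  exact: bounded01_ancestral_prob.
- move=> n; rewrite death_expect0; last exact: bounded01_ancestral_prob.
  rewrite /ancestral_transition big_ord_recl /= death_coef_init// mul1r subn0.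
  rewrite big1 ?addr0 ?subrr// => j _; rewrite death_coef_init ?mul0r//.
  by rewrite (leq_trans (ltn_ord j))// leq_subr.
Qed.

Lemma cvg_ancestral_transition s r t : (r <= s)%N ->
  ancestral_transition s r n t @[n --> \oo] --> (death_coef theta s (s - r) t : R).
Proof.
move=> rs.
have -> : death_coef theta s (s - r) t =
    \sum_(j < (s - r).+1) death_coef theta s j t * ((s - j)%N == r)%:R.
  rewrite big_ord_recr /= subKn// eqxx mulr1 big1 ?add0r// => j _.
  rewrite gtn_eqF ?mulr0// ltn_subRL addnC -ltn_subRL; exact: ltn_ord.
rewrite /ancestral_transition; apply: cvg_big => [|j _]; first exact: add_continuous.
by apply: cvgM; [exact: cvg_cst|exact: cvg_ancestral_prob].
Qed.

Lemma death_expect_ancestral_prob_cvg s r t : (r <= s)%N -> 0 <= t ->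
  seq_expect (P t n) (fun M => ancestral_prob theta M s r) @[n --> \oo] -->
  (death_coef theta s (s - r) t : R).
Proof.
move=> rs t0; under eq_fun do rewrite death_expect_ancestral_prob//.
exact: cvg_ancestral_transition.
Qed.

Lemma seq_law_sum_le1 (p : nat -> R) (s : seq nat) : seq_law p -> uniq s ->
  \sum_(k <- s) p k <= 1.
Proof.
move=> pl us; have f01 : bounded01 (fun=> 0 : R) by move=> k; rewrite lexx ler01.
have [r _] := seq_expect_split pl f01 us (lexx _) (fun _ _ => lexx 0).
by rewrite mul0r => /andP[r0] /(le_trans r0); rewrite subr_ge0.
Qed.

Lemma death_rate_unbounded (A : R) : exists n, A <= lambda n.
Proof.
(* lambda_(n+1) = (n + 1) (theta + n) / 2 >= n theta / 2 >= |A|. *)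
pose n := Num.bound (2 * `|A| / theta).
have nA : 2 * `|A| / theta < n%:R.
  by apply: archi_boundP; rewrite divr_ge0// ?mulr_ge0// ltW.
have : 2 * `|A| <= n%:R * theta by rewrite -ler_pdivrMr// ltW.
exists n.+1; rewrite /death_rate -natr1 addrA addrK (le_trans (ler_norm A))//.
rewrite ler_pdivlMr// mulrC (le_trans H)//.
have : 0 <= n%:R :> R by [].
by move: theta_gt0; nra.
Qed.

(** On the diagonal r = s the average of h_M(s, s) is e^(-lambda_s t) h_n(s, s), at most eps / 2 for
    every n once s is large. As h_M(s, s) >= 1/2 for M >= K, the mass beyond K is at most eps. *)
Lemma death_tight t (eps : R) : 0 < t -> 0 < eps ->
  exists K, forall n, 1 - \sum_(k <- iota 0 K) P t n k <= eps.
Proof.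
(* lambda_s t >= 2 / eps gives e^(lambda_s t) >= 1 + lambda_s t >= 2 / eps. *)
move=> t0 eps0; have [s sA] := death_rate_unbounded (2 / eps / t).
have es : expR (- lambda s * t) <= eps / 2.
  rewrite mulNr expRN -[leRHS]invrK lef_pV2 ?posrE ?expR_gt0 ?invr_gt0 ?divr_gt0//.
  rewrite invf_div (le_trans _ (expR_ge1Dx _))// -[leLHS]add0r lerD//.
  by rewrite -ler_pdivrMr.
have half : 0 < 2^-1 :> R by rewrite invr_gt0.
have := @cvg_ancestral_prob _ theta s s theta_gt0; rewrite eqxx => /cvgrPdist_le /(_ _ half).
move=> [K _ HK]; exists K => n.
have hK k : k \notin iota 0 K -> 2^-1 <= ancestral_prob theta k s s.
  rewrite mem_iota /= add0n -leqNgt => /HK; rewrite ler_norml => /andP[_].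
  by rewrite -[true%:R]/(1 : R); lra.
have [r Er] := seq_expect_split (death_seq_law n (ltW t0)) (bounded01_ancestral_prob s s)
  (iota_uniq 0 K) (ltW half) hK.
rewrite death_expect_ancestral_prob ?(ltW t0)// in Er.
move: Er; rewrite /ancestral_transition subnn big_ord1 death_coef0 subn0 => Er /andP[r1 _].
have : expR (- lambda s * t) * ancestral_prob theta n s s <= eps / 2.
  by rewrite (le_trans _ es)// ler_piMr ?expR_ge0// ancestral_prob_le1.
rewrite Er => H.
have S0 : 0 <= \sum_(k <- iota 0 K) P t n k * ancestral_prob theta k s s.
  by apply: sumr_ge0 => k _; rewrite mulr_ge0 ?ancestral_prob_ge0//; case: (death_seq_law n (ltW t0)).
by move: S0 H r1; lra.
Qed.

(** By tightness finitely many states matter, uniformly in n. On these, symmetry makes h_k(s, r)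
    close to [k = r] for large s, so P(D_t = r | D_0 = n) is close to the average of h, which
    converges as n grows. *)
Lemma cvg_death_from_infinity r t : 0 < t -> cvgn (P t ^~ r).
Proof.
move=> t0; apply: cauchy_cvg; apply: cauchy_exP => eps eps0.
have eps4 : 0 < eps / 4 by rewrite divr_gt0.
have [K0 HK0] := death_tight t0 eps4.
(* The window 0, ..., K - 1 must contain the state r itself. *)
pose K := maxn K0 r.+1.
have HK n : 1 - \sum_(k <- iota 0 K) P t n k <= eps / 4.
  apply: le_trans (HK0 n); rewrite lerD2l lerN2.
  have -> : K = (K0 + (K - K0))%N by rewrite subnKC ?leq_maxl.
  rewrite iotaD.
  by rewrite big_cat /= lerDl sumr_ge0// => k _; case: (death_seq_law n (ltW t0)).
have [s rs Hs] : exists2 s, (r <= s)%N &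
    \sum_(k <- iota 0 K) `|(r == k)%:R - ancestral_prob theta k s r| <= eps / 4.
  have : \sum_(k <- iota 0 K) `|(r == k)%:R - ancestral_prob theta k s r| @[s --> \oo] --> (0 : R).
    rewrite -[X in _ --> X](_ : \sum_(k <- iota 0 K) `|(r == k)%:R - (r == k)%:R| = 0).
      apply: cvg_big => [|k _]; first exact: add_continuous.
      apply: cvg_norm; apply: cvgB; first exact: cvg_cst.
      rewrite eq_sym; under eq_fun do rewrite ancestral_prob_sym.
      exact: cvg_ancestral_prob.
    by rewrite big1// => k _; rewrite subrr normr0.
  move=> /cvgrPdist_le /(_ _ eps4) [N _ HN]; exists (maxn N r); first exact: leq_maxr.
  have := HN (maxn N r) (leq_maxl _ _); rewrite /= sub0r normrN ger0_norm//.
  by rewrite sumr_ge0.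
(* The Cauchy criterion asks for a centre near all late terms. The three errors, each at most eps /
   4, are the convergence of the average, the tail beyond K and the replacement of h by [k = r]. *)
exists (death_coef theta s (s - r) t).
have := death_expect_ancestral_prob_cvg rs (ltW t0) => /cvgrPdist_le /(_ _ eps4).
apply: filterS => n; rewrite /ball /= => Hn.
have f0 k : k \notin iota 0 K -> 0 <= ancestral_prob theta k s r.
  by move=> _; exact: ancestral_prob_ge0.
have pl := death_seq_law n (ltW t0).
have [e Ee] := seq_expect_split pl (bounded01_ancestral_prob s r) (iota_uniq 0 K) (lexx _) f0.
rewrite mul0r => /andP[e0 /le_trans/(_ (HK n)) e1].
have -> : P t n r = \sum_(k <- iota 0 K) P t n k * (r == k)%:R.
  rewrite (bigD1_seq r) ?iota_uniq//=; last by rewrite mem_iota add0n /K leq_max ltnSn orbT.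
  by rewrite eqxx mulr1 big1 ?addr0// => k kr; rewrite eq_sym (negbTE kr) mulr0.
rewrite Ee in Hn.
have : `|\sum_(k <- iota 0 K) P t n k * (r == k)%:R -
    \sum_(k <- iota 0 K) P t n k * ancestral_prob theta k s r| <= eps / 4.
  rewrite -sumrB (le_trans _ Hs)// (le_trans (ler_norm_sum _ _ _))//.
  apply: ler_sum => k _; rewrite -mulrBr normrM ler_piMl// ger0_norm; last by case: pl.
  by have := seq_law_sum_le1 pl (isT : uniq [:: k]); rewrite big_seq1.
move: Hn; rewrite !ler_norml ltr_norml => /andP[a1 a2] /andP[b1 b2].
by apply/andP; split; lra.
Qed.

Lemma death_from_infinity_ge0 r t : 0 < t -> 0 <= death_from_infinity P r t.
Proof.
move=> t0; apply: limr_ge; first exact: cvg_death_from_infinity.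
by apply: nearW => n; case: (death_seq_law n (ltW t0)).
Qed.

(** Exchange of the limit in n with the sum over M: partial sums never exceed c because all terms
    are nonnegative, and tightness brings them within eps of c. *)
Lemma death_from_infinity_ancestral_prob s r t : (r <= s)%N -> 0 < t ->
  (\sum_(0 <= M <oo) (death_from_infinity P M t * ancestral_prob theta M s r)%:E =
   (death_coef theta s (s - r) t)%:E)%E.
Proof.
move=> rs t0; set c := death_coef _ _ _ _.
pose h k := ancestral_prob theta k s r.
have h0 k : 0 <= h k by exact: ancestral_prob_ge0.
pose S K : R := \sum_(0 <= k < K) death_from_infinity P k t * h k.
have S_cvg K : \sum_(0 <= k < K) P t n k * h k @[n --> \oo] --> S K.
  apply: cvg_big => [|k _]; first exact: add_continuous.
  by apply: cvgM; [exact: cvg_death_from_infinity|exact: cvg_cst].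
have A_cvg := death_expect_ancestral_prob_cvg rs (ltW t0).
have split K n : exists2 e, seq_expect (P t n) h = \sum_(0 <= k < K) P t n k * h k + e &
    0 <= e <= 1 - \sum_(k <- iota 0 K) P t n k.
  have [e] := seq_expect_split (death_seq_law n (ltW t0)) (bounded01_ancestral_prob s r)
    (iota_uniq 0 K) (lexx _) (fun k _ => h0 k).
  by rewrite mul0r => E eb; exists e => //; rewrite /index_iota subn0.
have Sc K : S K <= c.
  apply: ler_cvg_to (S_cvg K) A_cvg _; apply: nearW => n.
  by have [e -> /andP[e0 _]] := split K n; rewrite lerDl.
have Snd : {homo S : m n / (m <= n)%N >-> m <= n}.
  apply/nondecreasing_seqP => n; rewrite /S big_nat_recr//= lerDl mulr_ge0//.
  exact: death_from_infinity_ge0.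
have S_c : S K @[K --> \oo] --> c.
  apply/cvgrPdist_le => eps eps0; have [K HK] := death_tight t0 eps0.
  exists K => // K' /= KK'; rewrite ger0_norm ?subr_ge0//.
  rewrite lerBlDr -lerBlDl (le_trans _ (Snd _ _ KK'))//.
  apply: ler_cvg_to (cvgB A_cvg (cvg_cst eps)) (S_cvg K) _; apply: nearW => n.
  have [e Ee /andP[_ e1]] := split K n.
  rewrite -[leLHS]/(seq_expect (P t n) h - eps) Ee -addrA gerDl subr_le0.
  exact: le_trans (HK n).
apply/cvg_lim => //; under eq_fun do rewrite sumEFin.
by apply: cvg_EFin => //; exact: nearW.
Qed.

End pure_death_duality.

(** * The urn formula for the Dirichlet law *)

Section urn_formula.
Context {R : realType}.
Variables (k : nat) (C : set (k.-tuple R)).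
Hypothesis mC : measurable C.
Variables (K N : nat) (n : {ffun 'I_K -> nat}) (c : 'I_K -> 'I_k).
Hypothesis nN : forall l, (n l < N)%N.
Implicit Type a : 'I_k -> R.

(** Dirichlet parameters of alpha + sum_l i_l delta_(y_l) on a partition: [a] holds the cell masses
    of alpha and [c l] is the cell of y_l. *)
Definition shift_by a (i : 'I_K -> nat) : 'I_k -> R :=
  fun j => a j + (\sum_(l < K | c l == j) i l)%N%:R.

Lemma incr_ge0 a j : (forall i, 0 <= a i) -> forall i, 0 <= incr a j i.
Proof. by move=> a0 i; rewrite addr_ge0. Qed.

Lemma shift_by_ge0 a i : (forall j, 0 <= a j) -> forall j, 0 <= shift_by a i j.
Proof. by move=> a0 j; rewrite addr_ge0. Qed.

Lemma sum_incr a j : \sum_(i < k) incr a j i = \sum_(i < k) a i + 1.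
Proof.
rewrite big_split /=; congr (_ + _); rewrite (bigD1 j)//= eqxx big1 ?addr0//.
by move=> i /negbTE ->.
Qed.

Lemma sum_shift_by a i : \sum_(j < k) shift_by a i j = \sum_(j < k) a j + (\sum_(l < K) i l)%N%:R.
Proof.
rewrite big_split /=; congr (_ + _); rewrite -natr_sum; congr _%:R.
rewrite [RHS](partition_big c xpredT)//=.
Qed.

Lemma incr_shift_by a i j : incr (shift_by a i) j = shift_by (incr a j) i.
Proof. by apply/funext => j'; rewrite /incr /shift_by addrAC. Qed.

Lemma shift_by_incr a i l :
  shift_by (incr a (c l)) i = shift_by a (fun l' => (i l' + (l' == l))%N).
Proof.
apply/funext => j; rewrite /shift_by /incr -addrA; congr (_ + _).
rewrite big_split /= natrD addrC; congr (_ + _%:R).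
have [->|jl] := eqVneq j (c l).
  rewrite (bigD1 l)//= eqxx big1 ?addn0// => l' /andP[_ /negbTE ->//].
by rewrite big1// => l' /eqP cl'; case: eqVneq => // ll'; rewrite -cl' ll' eqxx in jl.
Qed.

Lemma dirichlet_expect_urn_mass M a : (forall j, 0 <= a j) -> 0 < \sum_(j < k) a j ->
  (dirichlet_expect (shift_by a n) (EFin \o urn_mass C M a) =
   (\sum_(i : index_vec K N) bin_prod n i *
      ancestral_weight (\sum_(j < k) a j) M (\sum_(l < K) n l) (\sum_(l < K) i l) *
      dirichlet_mass C (shift_by a (fun l => i l)))%:E)%E.
Proof.
elim: M a => [|M IH] a a0; set theta := \sum_(j < k) a j; set s := (\sum_(l < K) n l)%N;
  move=> ta0.
  rewrite -[EFin \o _]/(cst (dirichlet_mass C a)%:E) dirichlet_expect_cst; congr (_%:E).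
  pose i0 : index_vec K N := [ffun=> ord0].
  rewrite (bigD1 i0)//= [X in _ = _ + X]big1 ?addr0; last first.
    move=> i ii0; rewrite ancestral_weight0//.
    rewrite (_ : (\sum_(l < K) i l == 0)%N = false) ?mulr0 ?mul0r//.
    apply: contra_neqF ii0; rewrite sum_nat_eq0 => /forallP i0P; apply/ffunP => l.
    by rewrite ffunE; apply: val_inj; apply/eqP; exact: i0P.
  rewrite /bin_prod [X in _ = X * _ * _]big1; last by move=> l _; rewrite ffunE bin0.
  rewrite ancestral_weight0// (_ : (\sum_(l < K) i0 l)%N = 0%N) ?eqxx ?mul1r; last first.
    by rewrite big1// => l _; rewrite ffunE.
  congr dirichlet_mass; apply/funext => j; rewrite /shift_by big1 ?addr0// => l _.
  by rewrite ffunE.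
have ts0 : 0 < theta + s%:R by rewrite ltr_pwDl.
have ts : theta + s%:R = \sum_(j < k) shift_by a n j by rewrite sum_shift_by.
have b0 := shift_by_ge0 n a0.
have mu j : measurable_fun setT (EFin \o urn_mass C M (incr a j)).
  by apply/measurable_EFinP; exact: measurable_urn_mass.
have mtn j : measurable_fun setT (fun v : k.-tuple R => (`|tnth v j|)%:E).
  by apply/measurable_EFinP; apply: measurableT_comp => //; exact: measurable_tnth.
pose Y j := \sum_(i : index_vec K N) bin_prod n i *
      ancestral_weight (theta + 1) M s (\sum_(l < K) i l) *
      dirichlet_mass C (shift_by (incr a j) (fun l => i l)).
(* Size-biasing by the first draw increments parameter j both in the law and in the urn, so the
   induction hypothesis applies with [incr a j], of total mass theta + 1. *)
have step : ((theta + s%:R)%:E * dirichlet_expect (shift_by a n) (EFin \o urn_mass C M.+1 a) =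
    (\sum_(j < k) shift_by a n j * Y j)%:E)%E.
  rewrite (_ : EFin \o urn_mass C M.+1 a = (fun v => \sum_(j < k) (`|tnth v j|)%:E *
      (EFin \o urn_mass C M (incr a j)) v)%E); last first.
    by apply/funext => v; rewrite /= -sumEFin; apply: eq_bigr => j _; rewrite EFinM.
  rewrite /dirichlet_expect ge0_integral_sum//; last 2 first.
  - move=> j; exact: (measurable_normalize_comp (emeasurable_funM (mtn j) (mu j))).
  - by move=> j z _; rewrite mule_ge0// lee_fin urn_mass_ge0.
  rewrite ge0_sume_distrr; last first.
    move=> j _; apply: integral_ge0 => z _.
    by rewrite mule_ge0// lee_fin urn_mass_ge0.
  rewrite -sumEFin; apply: eq_bigr => j _; rewrite ts.
  rewrite [LHS](@dirichlet_expect_coord _ _ (shift_by a n) j _ b0 (mu j)); last 2 first.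
  - by move=> v; rewrite lee_fin urn_mass_ge0.
  - apply: (@dirichlet_expect_lty _ _ _ _ 1) => //.
    + exact: measurable_urn_mass.
    + by move=> v; exact: urn_mass_ge0.
    + by move=> v v0 v1; exact: urn_mass_le1.
  rewrite incr_shift_by IH; [|exact: incr_ge0|by rewrite sum_incr addr_gt0].
  by rewrite sum_incr -EFinM.
(* The parameter for n is that for i plus the atoms n_l - i_l of colour j. The first part collapses
   to theta + |i| by [dirichlet_mass_incr], the second is moved from i to its increment by
   [bin_prod_reindex], and [ancestral_weightS] adds the two. *)
have alg : \sum_(j < k) shift_by a n j * Y j = (theta + s%:R) *
    \sum_(i : index_vec K N) bin_prod n i *
      ancestral_weight theta M.+1 s (\sum_(l < K) i l) *
      dirichlet_mass C (shift_by a (fun l => i l)).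
  pose w := ancestral_weight (theta + 1) M s.
  pose D (i : 'I_K -> nat) := dirichlet_mass C (shift_by a i).
  pose phi (i : 'I_K -> nat) := w (\sum_(l < K) i l)%N.-1 * D i.
  pose Dj (i : index_vec K N) j := dirichlet_mass C (shift_by (incr a j) (fun l => i l)).
  have -> : \sum_(j < k) shift_by a n j * Y j = \sum_(i : index_vec K N)
      bin_prod n i * w (\sum_(l < K) i l)%N * \sum_(j < k) shift_by a n j * Dj i j.
    rewrite /Y; under eq_bigr do rewrite mulr_sumr.
    rewrite exchange_big /=; apply: eq_bigr => i _; rewrite mulr_sumr.
    by apply: eq_bigr => j _; rewrite /w /Dj; ring.
  have -> : (theta + s%:R) * (\sum_(i : index_vec K N) bin_prod n i *
        ancestral_weight theta M.+1 s (\sum_(l < K) i l) * D (fun l => i l)) =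
      \sum_(i : index_vec K N) bin_prod n i * w (\sum_(l < K) i l)%N *
        (\sum_(j < k) shift_by a (fun l => i l) j * Dj i j) +
      \sum_(i : index_vec K N) bin_prod n i * (\sum_(l < K) i l)%N%:R * phi (fun l => i l).
    rewrite mulr_sumr -big_split /=; apply: eq_bigr => i _.
    have <- : (theta + (\sum_(l < K) i l)%N%:R) * D (fun l => i l) =
        \sum_(j < k) shift_by a (fun l => i l) j * Dj i j.
      rewrite -sum_shift_by (dirichlet_mass_incr mC (shift_by_ge0 _ a0)).
      by apply: eq_bigr => j _; rewrite incr_shift_by.
    have H := ancestral_weightS M s (\sum_(l < K) i l)%N ta0.
    transitivity (bin_prod n i * D (fun l => i l) * ((theta + s%:R) *
      ancestral_weight theta M.+1 s (\sum_(l < K) i l)%N)); first by ring.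
    by rewrite H /phi /w /D; ring.
  apply/eqP; rewrite addrC -subr_eq -sumrB; apply/eqP.
  transitivity (\sum_(l < K) \sum_(i : index_vec K N) bin_prod n i * ((n l)%:R - (i l)%:R) *
      phi (fun l' => (i l' + (l' == l))%N)).
    rewrite exchange_big /=; apply: eq_bigr => i _; rewrite -mulrBr -sumrB.
    rewrite (eq_bigr (fun j => \sum_(l < K | c l == j) ((n l)%:R - (i l)%:R) * Dj i (c l))).
      transitivity (bin_prod n i * w (\sum_(l < K) i l)%N *
          \sum_(l < K) ((n l)%:R - (i l)%:R) * Dj i (c l)).
        by congr (_ * _); rewrite [RHS](partition_big c xpredT).
      rewrite mulr_sumr; apply: eq_bigr => l _.
      have sE : (\sum_(l' < K) (i l' + (l' == l)) = (\sum_(l' < K) i l').+1)%N.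
        rewrite big_split /= -[RHS]addn1; congr addn; rewrite (bigD1 l)//= eqxx big1//.
        by move=> l' /negbTE ->.
      by rewrite /phi /D -shift_by_incr sE /= /Dj; ring.
    move=> j _; rewrite -mulrBl /shift_by opprD addrACA subrr add0r !natr_sum -sumrB mulr_suml.
    by apply: eq_bigr => l /eqP ->.
  under eq_bigr do rewrite bin_prod_reindex//.
  rewrite exchange_big /=; apply: eq_bigr => i _.
  by rewrite -mulr_suml -mulr_sumr natr_sum.
have tsK : ((theta + s%:R)^-1 * (theta + s%:R))%R = 1 by rewrite mulVf// gt_eqF.
rewrite -[LHS]mul1e -[in LHS]tsK [X in (X * _ = _)%E]EFinM -muleA step alg -EFinM.
by rewrite mulrA tsK mul1r.
Qed.

End urn_formula.

(** * Measurable dependence on the sampled measure *)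

Section product_kernel.
Context d (T : measurableType d) (R : realType).
Local Open Scope ereal_scope.

Lemma measurable_probability_ev (A : set T) : measurable A ->
  measurable_fun [set: pprobability T R] (fun x : pprobability T R => (x : probability T R) A).
Proof.
move=> mA.
have mid : measurable_fun [set: pprobability T R] (id : pprobability T R -> pprobability T R).
  exact: measurable_id.
exact: (measurable_kernel (kprobability mid) A mA).
Qed.

(** The parameter space X is arbitrary so that induction on M can move the first coordinate into the
    parameter, replacing X by X times T. *)
Lemma measurable_tuple_product_integral M d' (X : measurableType d')
    (P : X -> pprobability T R) (f : X * M.-tuple T -> \bar R) :
  measurable_fun [set: X] P -> measurable_fun setT f -> (forall z, 0 <= f z) ->
  measurable_fun [set: X]
    (fun x => \int[tuple_product (fun _ : 'I_M => (P x : probability T R))]_y f (x, y)).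
Proof.
elim: M d' X P f => [|M IH] d' X P f mP mf f0.
  rewrite (_ : (fun x => _) = (fun x => f (x, [tuple]))).
    by apply: (measurableT_comp mf); exact: measurable_fun_pair.
  apply/funext => x; rewrite (integral_tuple_product0 _ (f := fun y => f (x, y)))//.
  by apply: (measurableT_comp mf); exact: measurable_fun_pair.
pose f' (p : (X * T) * M.-tuple T) := f (p.1.1, tcons (p.1.2, p.2)).
have mf' : measurable_fun setT f'.
  apply: (measurableT_comp mf); apply: measurable_fun_pair.
    exact: measurableT_comp.
  apply: (measurableT_comp (@measurable_tcons _ T M)); apply: measurable_fun_pair => //.
  exact: measurableT_comp.
have mP' : measurable_fun [set: X * T] (fun p : X * T => P p.1) by exact: measurableT_comp.
have H := IH _ _ (fun p : X * T => P p.1) f' mP' mf' (fun z => f0 _).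
rewrite (_ : (fun x => _) = (fun x => \int[kprobability mP x]_y0
    \int[tuple_product (fun _ : 'I_M => (P x : probability T R))]_y f' ((x, y0), y))); last first.
  apply/funext => x; rewrite (integral_tuple_productS _ (f := fun y => f (x, y)))//.
  by apply: (measurableT_comp mf); exact: measurable_fun_pair.
apply: (measurable_fun_integral_finite_kernel (fun p : X * T =>
  \int[tuple_product (fun _ : 'I_M => (P p.1 : probability T R))]_y f' (p, y))
  (kprobability mP)) => //.
by move=> z; apply: integral_ge0 => y _; exact: f0.
Qed.

End product_kernel.

(** * Finite partitions and cylinder sets *)

Section cells.
Context d (T : measurableType d) (R : realType).
Variables (k : nat) (c : T -> 'I_k).
Hypothesis mc : forall j, measurable (c @^-1` [set j]).
Local Open Scope ereal_scope.

(** A finite partition is encoded by its colouring [c], so that its cells are disjoint and cover the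
    space by construction. *)
Definition cell_masses (x : pprobability T R) : k.-tuple R :=
  [tuple fine ((x : probability T R) (c @^-1` [set j])) | j < k].

Lemma measurable_cell_masses : measurable_fun setT cell_masses.
Proof.
apply/measurable_fun_tnthP => j.
rewrite (_ : _ \o _ = (fun x : pprobability T R =>
    fine ((x : probability T R) (c @^-1` [set j])))); last first.
  by apply/funext => x; rewrite /= tnth_mktuple.
by apply: measurableT_comp => //; exact: measurable_probability_ev.
Qed.

Lemma cells_disjoint : trivIset setT (fun j => c @^-1` [set j]).
Proof. by move=> i j _ _ [y [/= -> ->]]. Qed.

Lemma cells_cover : \bigcup_j (c @^-1` [set j]) = [set: T].
Proof. by apply/seteqP; split => // y _; exists (c y). Qed.

Lemma integral_cells (x : {measure set T -> \bar R}) (h : 'I_k -> \bar R) : (forall j, 0 <= h j) ->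
  \int[x]_y h (c y) = \sum_(j < k) x (c @^-1` [set j]) * h j.
Proof.
move=> h0.
have mI j : measurable_fun setT (fun y : T => (\1_(c @^-1` [set j]) y)%:E : \bar R).
  exact/measurable_EFinP.
rewrite (eq_integral (fun y => \sum_(j < k) h j * (\1_(c @^-1` [set j]) y)%:E)); last first.
  move=> y _; rewrite (bigD1 (c y))//= big1 ?adde0.
    by rewrite indicE mem_set// mule1.
  by move=> j jc; rewrite indicE memNset ?mule0// => /= cj; rewrite cj eqxx in jc.
rewrite ge0_integral_sum//.
- apply: eq_bigr => j _; rewrite ge0_integralZl//.
  + by rewrite integral_indic// setIT muleC.
- by move=> j; exact: measurable_funeM.
- by move=> j y _; rewrite mule_ge0// lee_fin.
Qed.

Variable C : set (k.-tuple R).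
Hypothesis mC : measurable C.

Definition color_counts M (a : 'I_k -> R) (y : M.-tuple T) : 'I_k -> R :=
  shift_by (c \o tnth y) a (fun=> 1%N).

Lemma color_counts_tcons M a y0 (y : M.-tuple T) :
  color_counts a (tcons (y0, y)) = color_counts (incr a (c y0)) y.
Proof.
apply/funext => j; rewrite /color_counts /shift_by /incr -addrA; congr (_ + _)%R.
rewrite big_mkcond big_ord_recl /= natrD eq_sym tnth_tcons0; congr (_%:R + _%:R)%R.
by rewrite [RHS]big_mkcond; apply: eq_bigr => l _; rewrite /= tnth_tconsS.
Qed.

Lemma measurable_color_counts_mass M a :
  measurable_fun setT (fun y : M.-tuple T => (dirichlet_mass C (color_counts a y))%:E).
Proof.
elim: M a => [|M IH] a.
  rewrite (_ : (fun y => _) = cst (dirichlet_mass C (color_counts a [tuple]))%:E).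
    exact: measurable_cst.
  by apply/funext => y; rewrite (tuple0 y).
rewrite (_ : (fun y => _) = (fun y : M.+1.-tuple T => \sum_(j < k)
   (\1_(c @^-1` [set j]) (tnth y ord0))%:E *
   (dirichlet_mass C (color_counts (incr a j) [tuple of behead y]))%:E)); last first.
  apply/funext => y; rewrite (bigD1 (c (tnth y ord0)))//= big1 ?adde0.
    rewrite indicE mem_set// mul1e -color_counts_tcons.
    by rewrite [in LHS](tuple_eta y).
  by move=> j jc; rewrite indicE memNset ?mul0e// => /= cj; rewrite cj eqxx in jc.
apply: emeasurable_sum => j; apply: emeasurable_funM.
  apply/measurable_EFinP; apply: measurableT_comp => //; exact: measurable_tnth.
exact: (measurableT_comp (IH (incr a j)) (measurable_behead (n := M))).
Qed.

(** A draw matters only through its cell, so integrating out the draws one at a time leaves a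
    polynomial in the cell masses of x. *)
Lemma integral_color_counts_mass M a (x : probability T R) :
  \int[tuple_product (fun _ : 'I_M => x)]_y (dirichlet_mass C (color_counts a y))%:E =
  (urn_mass C M a (cell_masses x))%:E.
Proof.
have D0 b : (0 <= dirichlet_mass C b)%R by case/andP: (dirichlet_mass_bounds mC b).
elim: M a => [|M IH] a.
  rewrite integral_tuple_product0; last exact: measurable_color_counts_mass.
  by congr (dirichlet_mass C _)%:E; apply/funext => j; rewrite /color_counts /shift_by big_ord0 addr0.
rewrite integral_tuple_productS; last 2 first.
- exact: measurable_color_counts_mass.
- by move=> y; rewrite lee_fin.
transitivity (\int[x]_y0 (urn_mass C M (incr a (c y0)) (cell_masses x))%:E).
  apply: eq_integral => y0 _; rewrite -IH; apply: eq_integral => y _.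
  by rewrite color_counts_tcons.
rewrite (integral_cells x (h := fun j => (urn_mass C M (incr a j) (cell_masses x))%:E)); last first.
  by move=> j; rewrite lee_fin urn_mass_ge0.
rewrite /= -sumEFin; apply: eq_bigr => j _; rewrite EFinM; congr (_ * _).
rewrite tnth_mktuple ger0_norm ?fine_ge0// fineK//; exact: fin_num_measure.
Qed.

End cells.

Section cylinders.
Context d (T : measurableType d) (R : realType).
Local Open Scope ereal_scope.

Definition cylinder : set (set (pprobability T R)) :=
  [set B | exists k (c : T -> 'I_k) (C : set (k.-tuple R)),
    [/\ forall j, measurable (c @^-1` [set j]), measurable C &
        B = cell_masses c @^-1` C]].

Definition merge_coords k l (f : 'I_k -> 'I_l) (v : k.-tuple R) : l.-tuple R :=
  [tuple (\sum_(q < k | f q == j) tnth v q)%R | j < l].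

Lemma measurable_merge_coords k l (f : 'I_k -> 'I_l) :
  measurable_fun setT (merge_coords f).
Proof.
apply/measurable_fun_tnthP => j.
rewrite (_ : _ \o _ = (fun v : k.-tuple R => \sum_(q < k | f q == j) tnth v q)%R); last first.
  by apply/funext => v; rewrite /= tnth_mktuple.
under eq_fun do rewrite big_mkcond.
apply: measurable_sum => q; case: (f q == j); last exact: measurable_cst.
exact: measurable_tnth.
Qed.

Lemma cell_masses_comp k l (f : 'I_k -> 'I_l) (c : T -> 'I_k)
    (mc : forall j, measurable (c @^-1` [set j])) (x : pprobability T R) :
  cell_masses (f \o c) x = merge_coords f (cell_masses c x).
Proof.
apply: eq_from_tnth => j; rewrite !tnth_mktuple.
have h0 (q : 'I_k) : (0 <= (f q == j)%:R%:E :> \bar R) by rewrite lee_fin.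
have mfc : measurable ((f \o c) @^-1` [set j]).
  rewrite (_ : _ @^-1` _ = \bigcup_(q in [set q | f q = j]) (c @^-1` [set q])).
    by apply: fin_bigcup_measurable => //; exact: finite_finset.
  by apply/seteqP; split => y /=; [move=> fc; exists (c y)|move=> [q /= fq ->]].
transitivity (fine (\int[(x : probability T R)]_y (f (c y) == j)%:R%:E)).
  congr fine; rewrite (eq_integral (EFin \o \1_((f \o c) @^-1` [set j]))).
    by rewrite integral_indic// setIT.
  move=> y _; rewrite /= indicE; case: eqP => fc; first by rewrite mem_set.
  by rewrite memNset.
rewrite (integral_cells mc (x : probability T R) (h := fun q => (f q == j)%:R%:E))//.
rewrite [RHS]big_mkcond -[RHS]/(fine _%:E) -sumEFin; congr fine; apply: eq_bigr => q _.
rewrite tnth_mktuple; case: eqP => _; rewrite ?mule0// mule1 fineK//.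
exact: fin_num_measure.
Qed.

(** The pair of colours, enumerated, colours the common refinement; merging coordinates recovers the
    cell masses of both partitions. *)
Lemma cylinder_setI : setI_closed cylinder.
Proof.
move=> _ _ [k1 [c1 [C1 [mc1 mC1 ->]]]] [k2 [c2 [C2 [mc2 mC2 ->]]]].
pose c y : 'I_#|{: 'I_k1 * 'I_k2}| := enum_rank (c1 y, c2 y).
pose f1 (q : 'I_#|{: 'I_k1 * 'I_k2}|) := (enum_val q).1.
pose f2 (q : 'I_#|{: 'I_k1 * 'I_k2}|) := (enum_val q).2.
have mc j : measurable (c @^-1` [set j]).
  rewrite (_ : _ @^-1` _ = (c1 @^-1` [set f1 j]) `&` (c2 @^-1` [set f2 j])).
    exact: measurableI.
  apply/seteqP; split => y /=; rewrite /c /f1 /f2.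
    by move=> <-; rewrite enum_rankK.
  by move=> [-> ->]; rewrite -surjective_pairing enum_valK.
have c1E : c1 = f1 \o c by apply/funext => y; rewrite /= /c /f1 enum_rankK.
have c2E : c2 = f2 \o c by apply/funext => y; rewrite /= /c /f2 enum_rankK.
exists _, c, (merge_coords f1 @^-1` C1 `&` merge_coords f2 @^-1` C2); split => //.
  by apply: measurableI; rewrite -[X in measurable X]setTI; exact: measurable_merge_coords.
by apply/seteqP; split => x /=; rewrite c1E c2E !cell_masses_comp.
Qed.

Lemma cylinderT : cylinder setT.
Proof.
exists 1%N, (fun=> ord0), setT; split => // j.
by rewrite (ord1 j) (_ : _ @^-1` _ = setT)//; apply/seteqP.
Qed.

(** The generating sets { x : x(U) < r } are cylinders over the partition into U and its
    complement. *)
Lemma measurable_cylinder : @measurable _ (pprobability T R) = <<s cylinder >>.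
Proof.
apply/seteqP; split.
  apply: sub_sigma_algebra2 => _ [r _ [U mU <-]].
  pose c y : 'I_2 := if y \in U then ord0 else lift ord0 ord0.
  have cU : c @^-1` [set ord0] = U.
    apply/seteqP; split => y /=; rewrite /c; first by case: ifP => // /set_mem.
    by move=> Uy; rewrite mem_set.
  exists 2%N, c, ((fun v => tnth v ord0) @^-1` `]-oo, r[%classic); split.
  - move=> j; have [->|j0] := eqVneq j ord0; first by rewrite cU.
    rewrite (_ : _ @^-1` _ = ~` (c @^-1` [set ord0])); first by rewrite cU; exact: measurableC.
    apply/seteqP; split => y /=; first by move=> ->; apply/eqP.
    by move: j0; rewrite /c; case: ifP => // _; case: j => [[|[|]]]//= ? _ _; apply: val_inj.
  - by rewrite -[X in measurable X]setTI; exact: measurable_tnth.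
  - apply/seteqP; split => x /=; rewrite /mset /= in_itv /= tnth_mktuple cU -lte_fin fineK//;
      exact: fin_num_measure.
apply: smallest_sub; first exact: sigma_algebra_measurable.
move=> _ [k [c [C [mc mC ->]]]].
by rewrite -[X in measurable X]setTI; exact: measurable_cell_masses.
Qed.

End cylinders.

Section dirichlet_process_cells.
Context d (T : measurableType d) (R : realType).
Local Open Scope ereal_scope.
Variables (gamma : {measure set T -> \bar R}) (Q : random_measure_law T R).
Hypothesis QP : is_dirichlet_process gamma Q.
Variables (k : nat) (c : T -> 'I_k).
Hypothesis mc : forall j, measurable (c @^-1` [set j]).

Lemma dirichlet_process_cells C : measurable C ->
  Q (cell_masses c @^-1` C) =
  dirichlet_distribution (fun j => fine (gamma (c @^-1` [set j]))) C.
Proof. by move=> mC; apply: (QP mc) => //; [exact: cells_disjoint|exact: cells_cover]. Qed.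

Lemma integral_dirichlet_process_cells (f : k.-tuple R -> \bar R) :
  measurable_fun setT f -> (forall v, 0 <= f v) ->
  \int[Q]_x f (cell_masses c x) =
  dirichlet_expect (fun j => fine (gamma (c @^-1` [set j]))) f.
Proof.
move=> mf f0; rewrite /dirichlet_expect.
have mcell := measurable_cell_masses (R := R) mc.
have mnorm := @measurable_tuple_normalize R k.
have := @ge0_integral_pushforward _ _ _ _ _ _ mcell Q setT f measurableT mf (fun v _ => f0 v).
rewrite preimage_setT => <-.
have := @ge0_integral_pushforward _ _ _ _ _ _ mnorm
  (gamma_product (fun j => fine (gamma (c @^-1` [set j])))) setT f measurableT mf (fun v _ => f0 v).
rewrite preimage_setT => <-.
apply: eq_measure_integral => C mC _; exact: dirichlet_process_cells.
Qed.

End dirichlet_process_cells.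

(** * From finite-dimensional marginals to the laws on measures *)

Section dirichlet_urn_formula.
Context d (T : measurableType d) (R : realType).
Local Open Scope ereal_scope.
Variables (alpha : {measure set T -> \bar R}).
Variables (Pi : {measure set T -> \bar R} -> random_measure_law T R).
Hypothesis PiP : is_dirichlet_family Pi.
Hypothesis alpha_neq0 : alpha setT != 0.
Hypothesis alpha_lty : alpha setT < +oo.
Local Notation theta := (fine (alpha setT)).

Lemma fine_alpha_gt0 : (0 < theta)%R.
Proof. by rewrite fine_gt0// lt0e alpha_neq0 measure_ge0 alpha_lty. Qed.

Lemma add_atoms_neq0 K w (y : 'I_K -> T) : add_atoms alpha w y setT != 0.
Proof.
rewrite gt_eqF// /add_atoms (@lt_le_trans _ _ (alpha setT))//; first by rewrite lt0e alpha_neq0/=.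
by rewrite leeDl// sume_ge0// => j _; rewrite mule_ge0.
Qed.

Lemma add_atoms_lty K w (y : 'I_K -> T) : add_atoms alpha w y setT < +oo.
Proof.
rewrite /add_atoms lte_add_pinfty// lte_sum_pinfty// => j _.
by rewrite diracE mem_set// mule1 ltry.
Qed.

Lemma fin_num_alpha A : measurable A -> alpha A \is a fin_num.
Proof.
move=> mA; rewrite ge0_fin_numE// (le_lt_trans _ alpha_lty)//.
by apply: le_measure; rewrite ?inE.
Qed.

Let alpha_cells k (c : T -> 'I_k) : 'I_k -> R := fun j => fine (alpha (c @^-1` [set j])).

Lemma add_atoms_cells k (c : T -> 'I_k) K w (y : 'I_K -> T) :
  (forall j, measurable (c @^-1` [set j])) ->
  (fun j => fine (add_atoms alpha w y (c @^-1` [set j]))) =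
  shift_by (c \o y) (alpha_cells c) w.
Proof.
move=> mc; apply/funext => j; rewrite /add_atoms /shift_by /alpha_cells.
rewrite (_ : \sum_(l < K) _ = (\sum_(l < K | (c \o y) l == j) w l)%N%:R%:E); last first.
  rewrite natr_sum -sumEFin [RHS]big_mkcond; apply: eq_bigr => l _.
  rewrite diracE /=; case: eqP => cy; first by rewrite mem_set// mule1.
  by rewrite memNset// mule0.
by rewrite fineD//; exact: fin_num_alpha.
Qed.

Lemma sum_alpha_cells k (c : T -> 'I_k) : (forall j, measurable (c @^-1` [set j])) ->
  (\sum_(j < k) alpha_cells c j)%R = theta.
Proof.
move=> mc; apply: EFin_inj; rewrite fineK ?fin_num_alpha// -sumEFin.
have /= := integral_cells mc alpha (h := fun=> 1) (fun=> lee01).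
rewrite integral_cst// mul1e => ->; apply: eq_bigr => j _.
by rewrite mule1 fineK//; exact: fin_num_alpha.
Qed.

Lemma dirichlet_family_cells k (c : T -> 'I_k) C K w (y : 'I_K -> T) :
  (forall j, measurable (c @^-1` [set j])) -> measurable C ->
  Pi (add_atoms alpha w y) (cell_masses c @^-1` C) =
  (dirichlet_mass C (shift_by (c \o y) (alpha_cells c) w))%:E.
Proof.
move=> mc mC; have Q := PiP (add_atoms_neq0 w y) (add_atoms_lty w y).
by rewrite (dirichlet_process_cells Q mc mC) add_atoms_cells// dirichlet_massE.
Qed.

Variables (K N M : nat) (n : {ffun 'I_K -> nat}) (y : 'I_K -> T).
Hypothesis nN : forall l, (n l < N)%N.

Let one_sample (B : set (pprobability T R)) (z : M.-tuple T) : \bar R :=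
  Pi (add_atoms alpha (fun=> 1%N) (tnth z)) B.

Let sample (B : set (pprobability T R)) (x : pprobability T R) : \bar R :=
  \int[tuple_product (fun _ : 'I_M => (x : probability T R))]_z one_sample B z.

Let urn_coef (i : index_vec K N) : R :=
  bin_prod n i * ancestral_weight theta M (\sum_(l < K) n l) (\sum_(l < K) i l).

Let mixture (B : set (pprobability T R)) : \bar R :=
  \sum_(i : index_vec K N) (urn_coef i)%:E * Pi (add_atoms alpha (fun l => i l) y) B.

(** [Pi] comes with no measurability in its parameter, so measurability of the integrand is carried
    through the Dynkin induction together with the identity. *)
Let urn_formula B := measurable_fun setT (one_sample B) /\
  \int[Pi (add_atoms alpha n y)]_x sample B x = mixture B.

Let urn_formula_cylinder B : cylinder B -> urn_formula B.
Proof.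
move=> [k [c [C [mc mC ->]]]].
have oneE : one_sample (cell_masses c @^-1` C) =
    fun z => (dirichlet_mass C (color_counts c (alpha_cells c) z))%:E.
  by apply/funext => z; exact: dirichlet_family_cells.
split; first by rewrite oneE; exact: measurable_color_counts_mass.
have sampleE x : sample (cell_masses c @^-1` C) x =
    (urn_mass C M (alpha_cells c) (cell_masses c x))%:E.
  by rewrite -(integral_color_counts_mass mc mC) /sample oneE.
under eq_integral do rewrite sampleE.
have Q := PiP (add_atoms_neq0 n y) (add_atoms_lty n y).
rewrite (integral_dirichlet_process_cells Q mc (f := EFin \o urn_mass C M (alpha_cells c))); last 2 first.
- by apply/measurable_EFinP; exact: measurable_urn_mass.
- by move=> v; rewrite lee_fin urn_mass_ge0.
rewrite add_atoms_cells// (dirichlet_expect_urn_mass mC _ nN); last 2 first.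
- by move=> j; rewrite fine_ge0.
- by rewrite sum_alpha_cells// fine_alpha_gt0.
rewrite -sumEFin; apply: eq_bigr => i _.
by rewrite dirichlet_family_cells// EFinM sum_alpha_cells.
Qed.

Let urn_coef_ge0 i : (0 <= urn_coef i)%R.
Proof. apply: mulr_ge0; first exact: prodr_ge0.
exact: ancestral_weight_ge0 fine_alpha_gt0. Qed.

Let measurable_sample B : measurable_fun setT (one_sample B) -> measurable_fun setT (sample B).
Proof.
move=> mB; apply: (measurable_tuple_product_integral (P := id) (f := fun p => one_sample B p.2)) => //.
exact: measurableT_comp.
Qed.

Let sampleT x : sample setT x = 1.
Proof.
rewrite /sample (eq_integral (cst 1)); last by move=> z _; exact: probability_setT.
by rewrite integral_cst// mul1e; exact: probability_setT.
Qed.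

(** The two sides for B and for its complement add up to those for the whole space, and the finite
    [mixture B] can be cancelled. *)
Let urn_formulaC B : measurable B -> urn_formula B -> urn_formula (~` B).
Proof.
move=> mB [m1 iB].
have [_ iT] := urn_formula_cylinder (cylinderT T R).
have oneC z : one_sample (~` B) z = 1 - one_sample B z by exact: probability_setC.
have one_le1 z : one_sample B z <= 1 by exact: probability_le1.
have one_fin z : one_sample B z \is a fin_num by exact: fin_num_measure.
have m1C : measurable_fun setT (one_sample (~` B)).
  by rewrite (funext oneC); apply: emeasurable_funB.
split=> //.
have sampleD x : sample B x + sample (~` B) x = 1.
  rewrite -(sampleT x) /sample -ge0_integralD//.
  by apply: eq_integral => z _; rewrite -measureU ?setUv ?setICr//; exact: measurableC.
have iD : \int[Pi (add_atoms alpha n y)]_x sample B x +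
    \int[Pi (add_atoms alpha n y)]_x sample (~` B) x = mixture B + mixture (~` B).
  rewrite -ge0_integralD//; last 4 first.
  - by move=> x _; exact: integral_ge0.
  - exact: measurable_sample.
  - by move=> x _; exact: integral_ge0.
  - exact: measurable_sample.
  rewrite (eq_integral (sample setT)) ?iT; last by move=> x _; rewrite sampleD sampleT.
  rewrite -big_split; apply: eq_bigr => i _ /=.
  rewrite -ge0_muleDr// -measureU ?setUv ?setICr//; exact: measurableC.
have fB : mixture B \is a fin_num.
  by apply/sum_fin_numP => i _ _; rewrite fin_numM//; exact: fin_num_measure.
move: iD; rewrite iB => iD.
by rewrite -[LHS](addeK _ fB) [X in X - _]addeC iD [X in X - _]addeC addeK.
Qed.

Let urn_formula_bigcup (F : (set (pprobability T R))^nat) :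
  (forall i, measurable (F i)) -> trivIset setT F ->
  (forall i, urn_formula (F i)) -> urn_formula (\bigcup_i F i).
Proof.
move=> mF tF uF.
have mUF : measurable (\bigcup_i F i) by exact: bigcupT_measurable.
have oneU : one_sample (\bigcup_i F i) = fun z => \sum_(i <oo) one_sample (F i) z.
  by apply/funext => z; exact: measure_semi_bigcup.
split.
  rewrite oneU; apply: ge0_emeasurable_sum => // i _; exact: (uF i).1.
have sampleU x : sample (\bigcup_i F i) x = \sum_(i <oo) sample (F i) x.
  rewrite /sample oneU integral_nneseries// => i; exact: (uF i).1.
rewrite (eq_integral _ _ (fun x _ => sampleU x)) integral_nneseries//; last 2 first.
- by move=> i; apply: measurable_sample; exact: (uF i).1.
- by move=> i x _; exact: integral_ge0.
transitivity (\sum_(i <oo) mixture (F i)).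
  by apply: eq_eseriesr => i _; exact: (uF i).2.
rewrite nneseries_sum; last by move=> i j _; rewrite mule_ge0// lee_fin urn_coef_ge0.
apply: eq_bigr => i _; rewrite nneseriesZl//; congr (_ * _).
by apply/esym; exact: measure_semi_bigcup.
Qed.

Lemma dirichlet_urn_formula B : measurable B ->
  measurable_fun setT (fun z : M.-tuple T => Pi (add_atoms alpha (fun=> 1%N) (tnth z)) B) /\
  \int[Pi (add_atoms alpha n y)]_x
    \int[tuple_product (fun _ : 'I_M => (x : probability T R))]_z
      Pi (add_atoms alpha (fun=> 1%N) (tnth z)) B =
  \sum_(i : index_vec K N)
    (bin_prod n i * ancestral_weight theta M (\sum_(l < K) n l) (\sum_(l < K) i l))%:E *
    Pi (add_atoms alpha (fun l => i l) y) B.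
Proof.
move=> mB; apply: (dynkin_induction (G := @cylinder _ T R) (P := urn_formula)).
- exact: measurable_cylinder.
- exact: cylinder_setI.
- exact: urn_formula_cylinder (cylinderT T R).
- exact: urn_formula_cylinder.
- exact: urn_formulaC.
- exact: urn_formula_bigcup.
- by rewrite -measurable_cylinder.
Qed.

End dirichlet_urn_formula.

(** * Prediction *)

Section transition_coefficients.
Context {R : realType}.
Variables (theta : R) (K : nat).

(** The case n = m fits the general formula, since its divided difference has a single node and all
    binomials are 1; elsewhere the binomials are symmetric under i -> m - i. *)
Lemma transition_probE (m n : {ffun 'I_K -> nat}) t : (forall j, n j <= m j)%N ->
  transition_prob theta m n t = (\prod_(j < K) 'C(m j, n j)%:R) *
    (death_coef theta (size_vec m) (size_vec m - size_vec n) t /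
     'C(size_vec m, size_vec n)%:R).
Proof.
move=> nm; set s := size_vec m.
have ns : (size_vec n <= s)%N by apply: leq_sum => j _; exact: nm.
have loss_size : size_vec [ffun j => m j - n j]%N = (s - size_vec n)%N.
  rewrite /s /size_vec -sumnB; last by move=> j _; exact: nm.
  by apply: eq_bigr => j _; rewrite ffunE.
rewrite /transition_prob /loss_prob; case: eqP => [mn|_].
  have <- : m = n.
    apply/ffunP => j; move/ffunP: mn => /(_ j); rewrite !ffunE => /eqP; rewrite subn_eq0 => mnj.
    by apply/eqP; rewrite eqn_leq mnj nm.
  rewrite subnn death_coef0 binn divr1 big1 ?mul1r// => j _.
  by rewrite binn.
rewrite /hypergeometric loss_size bin_sub// (eq_bigr (fun j => 'C(m j, n j)%:R)) => [|j _].
  by rewrite -/s [RHS]mulrC -[RHS]mulrA.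
by rewrite ffunE bin_sub.
Qed.

End transition_coefficients.

Section prediction_formula.
Context d (T : measurableType d) (R : realType).
Local Open Scope ereal_scope.
Variables (alpha : {measure set T -> \bar R}).
Variables (Pi : {measure set T -> \bar R} -> random_measure_law T R).
Hypothesis PiP : is_dirichlet_family Pi.
Hypothesis alpha_neq0 : alpha setT != 0.
Hypothesis alpha_lty : alpha setT < +oo.
Local Notation theta := (fine (alpha setT)).
Variable death : R -> nat -> nat -> R.
Hypothesis deathP : is_pure_death (death_rate theta) death.
Variable t : R.
Hypothesis t_gt0 : (0 < t)%R.
Variables (K N : nat) (m : {ffun 'I_K -> nat}) (y : 'I_K -> T).
Hypothesis mN : forall l, (m l < N)%N.

Let theta_gt0 := fine_alpha_gt0 alpha_neq0 alpha_lty.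

Let death_ge0 M : (0 <= death_from_infinity death M t)%R.
Proof. exact: death_from_infinity_ge0 deathP _ _ t_gt0. Qed.

(** w_M(s, r) is h_M(s, r) / C(s, r), so the sum over M is the averaged duality function; if some
    i_l > m_l, both sides vanish with [bin_prod]. *)
Lemma sum_death_bin_prod (i : index_vec K N) :
  \sum_(0 <= M <oo) (death_from_infinity death M t)%:E *
    (bin_prod m i * ancestral_weight theta M (size_vec m) (\sum_(l < K) i l))%:E =
  (bin_prod m i * (death_coef theta (size_vec m) (size_vec m - \sum_(l < K) i l) t /
    'C(size_vec m, \sum_(l < K) i l)%:R))%:E.
Proof.
have [le_im|/forallPn[l]] := boolP [forall l, i l <= m l]%N; last first.
  rewrite -ltnNge => ml.
  have -> : bin_prod m i = 0%R :> R by rewrite /bin_prod (bigD1 l)//= bin_small// mul0r.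
  by rewrite mul0r eseries0// => M _ _; rewrite mul0r mule0.
set r := (\sum_(l < K) i l)%N; set s := size_vec m.
have rs : (r <= s)%N by apply: leq_sum => l _; exact: (forallP le_im).
have C0 : ('C(s, r)%:R != 0 :> R)%R by rewrite pnatr_eq0 -lt0n bin_gt0.
rewrite [RHS]EFinM -(mulrC ('C(s, r)%:R^-1)%R) EFinM.
rewrite -(death_from_infinity_ancestral_prob theta_gt0 deathP rs t_gt0).
have da0 M : 0 <= (death_from_infinity death M t * ancestral_prob theta M s r)%:E.
  by rewrite lee_fin mulr_ge0// ancestral_prob_ge0.
rewrite -nneseriesZl// -nneseriesZl; last first.
  by move=> M _; rewrite mule_ge0// lee_fin invr_ge0.
apply: eq_eseriesr => M _; rewrite -!EFinM; congr EFin.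
rewrite /ancestral_prob mulrCA; congr (_ * _)%R.
by rewrite [in RHS]mulrCA; congr (_ * _)%R; rewrite mulKf.
Qed.

Lemma prediction_dirichlet B : measurable B ->
  prediction alpha Pi death t (Pi (add_atoms alpha m y)) B =
  \sum_(i : index_vec K N)
    (bin_prod m i * (death_coef theta (size_vec m) (size_vec m - \sum_(l < K) i l) t /
      'C(size_vec m, \sum_(l < K) i l)%:R))%:E *
    Pi (add_atoms alpha (fun l => i l) y) B.
Proof.
move=> mB; rewrite /prediction /fleming_viot.
have urn M := dirichlet_urn_formula PiP alpha_neq0 alpha_lty M y mN mB.
have msample M : measurable_fun setT (fun x : pprobability T R =>
    \int[tuple_product (fun _ : 'I_M => (x : probability T R))]_z
      Pi (add_atoms alpha (fun=> 1%N) (tnth z)) B).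
  apply: (measurable_tuple_product_integral (P := id)
    (f := fun p => Pi (add_atoms alpha (fun=> 1%N) (tnth p.2)) B)) => //.
  exact: (measurableT_comp (urn M).1).
rewrite integral_nneseries//; last 2 first.
- by move=> M; exact: measurable_funeM.
- by move=> M x _; rewrite mule_ge0 ?integral_ge0// lee_fin.
transitivity (\sum_(0 <= M <oo) \sum_(i : index_vec K N)
    ((death_from_infinity death M t)%:E *
      (bin_prod m i * ancestral_weight theta M (size_vec m) (\sum_(l < K) i l))%:E) *
    Pi (add_atoms alpha (fun l => i l) y) B).
  apply: eq_eseriesr => M _.
  rewrite ge0_integralZl//; last 2 first.
  - by move=> x _; exact: integral_ge0.
  - by rewrite lee_fin.
  rewrite (urn M).2 ge0_sume_distrr; last first.
    move=> i _; rewrite mule_ge0// lee_fin mulr_ge0//; first exact: prodr_ge0.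
    exact: ancestral_weight_ge0.
  by apply: eq_bigr => i _; rewrite muleA.
have term0 i M : 0 <= (death_from_infinity death M t)%:E *
    (bin_prod m i * ancestral_weight theta M (size_vec m) (\sum_(l < K) (i : index_vec K N) l))%:E.
  rewrite mule_ge0 ?lee_fin// mulr_ge0//; first exact: prodr_ge0.
  exact: ancestral_weight_ge0.
rewrite nneseries_sum; last by move=> i M _; exact: mule_ge0.
apply: eq_bigr => i _; rewrite -sum_death_bin_prod.
rewrite -(fineK (fin_num_measure (Pi (add_atoms alpha (fun l => i l) y)) B mB)) muleC.
by rewrite -nneseriesZl//; apply: eq_eseriesr => M _; rewrite muleC.
Qed.

Lemma prediction_dirichlet_lower_set B : measurable B ->
  prediction alpha Pi death t (Pi (add_atoms alpha m y)) B =
  \sum_(n \in lower_set m) (transition_prob theta m n t)%:E * Pi (add_atoms alpha n y) B.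
Proof.
move=> mB; rewrite prediction_dirichlet//.
pose s := size_vec m.
pose G (n : {ffun 'I_K -> nat}) := ((\prod_(j < K) 'C(m j, n j)%:R) *
  (death_coef theta s (s - size_vec n) t / 'C(s, size_vec n)%:R))%:E *
  Pi (add_atoms alpha n y) B.
pose phi (i : index_vec K N) : {ffun 'I_K -> nat} := [ffun l => i l : nat].
have phiE i : (phi i : 'I_K -> nat) = (fun l => i l : nat) by apply/funext => l; rewrite ffunE.
have phi_inj : injective phi.
  by move=> i j /ffunP ij; apply/ffunP => l; apply: val_inj; have := ij l; rewrite !ffunE.
rewrite (eq_fsbigr G); last by move=> n /set_mem nm; rewrite transition_probE.
(* The sum over the lower set is enlarged to the box, whose additional terms contain a vanishing
   binomial. *)
rewrite (@fsbig_fwiden _ _ _ _ (map phi (index_enum (index_vec K N)))).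
- rewrite big_map; apply: eq_bigr => i _.
  by rewrite /G /size_vec phiE.
- move=> n nm /=; apply/mapP; exists [ffun l => inord (n l)]; first exact: mem_index_enum.
  apply/ffunP => l; rewrite !ffunE inordK//.
  by rewrite (leq_ltn_trans (nm l))// (ltn_trans (mN l)).
- by rewrite map_inj_uniq// index_enum_uniq.
- move=> n [_ /= nm]; rewrite /G.
  have /existsNP[l /negP] := nm.
  by rewrite -ltnNge => ml; rewrite (bigD1 l)//= bin_small// !mul0r mul0e.
Qed.

End prediction_formula.

Theorem theorem3p2 (R : realType) (Y : ptopologicalType)
    (polishY : polish_space R Y) (lcY : locally_compact [set: Y])
    (theta : {posnum R})
    (P0 : probability (borel Y) R) (P0_nonatomic : forall y, P0 [set y] = 0%E)
    (Pi : {measure set (borel Y) -> \bar R} -> random_measure_law (borel Y) R)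
    (PiP : is_dirichlet_family Pi)
    (death : R -> nat -> nat -> R)
    (deathP : is_pure_death (death_rate theta%:num) death)
    (t : R) (t_gt0 : 0 < t)
    (K : nat) (y : 'I_K -> borel Y) (y_inj : injective y)
    (m : {ffun 'I_K -> nat}) :
  let alpha : {measure set (borel Y) -> \bar R} := mscale theta%:num%:nng P0 in
  forall B : set (pprobability (borel Y) R), measurable B ->
  (prediction alpha Pi death t (Pi (add_atoms alpha m y)) B =
   \sum_(n \in lower_set m)
     (transition_prob theta%:num m n t)%:E * Pi (add_atoms alpha n y) B)%E.
Proof.
move=> alpha B mB.
have alphaT : alpha [set: borel Y] = (theta%:num)%:E.
  by rewrite /alpha /= /mscale /= [X in (_ * X)%E](_ : _ = 1%E) ?mule1//; exact: probability_setT.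
have alpha0 : alpha [set: borel Y] != 0%E by rewrite alphaT eqe gt_eqF.
have alphaoo : (alpha [set: borel Y] < +oo)%E by rewrite alphaT ltry.
rewrite -[theta%:num]/(fine (theta%:num)%:E) -alphaT in deathP *.
(* The box size N = |m| + 1 exceeds every coordinate of m strictly. *)
have mN l : (m l < (size_vec m).+1)%N by rewrite ltnS /size_vec (bigD1 l)//= leq_addr.
exact: (prediction_dirichlet_lower_set PiP alpha0 alphaoo deathP t_gt0 y mN mB).
Qed.
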